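(* $\mathsf{AVG}_\tau\text{-}\mathsf{LCL}[O(1)]\subseteq\mathsf{BPP}$.
   Context: A catalytic-type machine has a read-only input tape, a write-only output tape, a read-write work tape and a read-write catalytic tape initially holding an arbitrary string $\tau$. Let $d$ denote Hamming distance. $\mathsf{AVG}_\tau\text{-}\mathsf{LCL}[O(1)]$ is the class of languages $L$ for which there are constants $k,e$ and a deterministic such machine with $k\log n$ work bits and $n^k$ catalytic bits that, on every input $x$ and every initial catalytic content $\tau\in\{0,1\}^{n^k}$, outputs $L(x)$, and whose final catalytic content $\tau'$ satisfies $\mathbb{E}_\tau[d(\tau,\tau')]\le e$ for $\tau$ uniform (for every $x$). No time bound is imposed on the machine. *)

(* Defs.v *)
From mathcomp Require Import all_boot all_order all_algebra.
Unset Strict Implicit. Unset Printing Implicit Defensive.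
Import Order.TTheory GRing.Theory Num.Theory.

Inductive move := MoveL | MoveS | MoveR.

(* A deterministic machine with four binary tapes:
   - input tape  (read-only),
   - aux tape    (read-only; used as the random tape for BPP, empty otherwise),
   - work tape   (read-write, of a prescribed length),
   - catalytic tape (read-write, of a prescribed length; empty for BPP).
   Every tape of content s is delimited by end markers: head positions range
   over 0 .. size s + 1, cells 0 and size s + 1 read as [None] (marker) and
   cannot be overwritten; cell h (1 <= h <= size s) holds nth false s (h-1).
   The output is given by halting: [halt q = Some b] means the machine has
   halted and its (one-bit) output is b. *)
Record machine := Machine {
  mQ : finType;
  mq0 : mQ;
  mhalt : mQ -> option bool;
  mdelta : mQ -> option bool -> option bool -> option bool -> option bool ->
           mQ * move * move * (bool * move) * (bool * move)
}.

Record config (Q : Type) := Config {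
  cstate : Q;
  cin : nat; caux : nat; cwork : nat; ccat : nat;
  cwtape : seq bool; cctape : seq bool
}.
Arguments Config {Q}.
Arguments cstate {Q}. Arguments cin {Q}. Arguments caux {Q}.
Arguments cwork {Q}. Arguments ccat {Q}. Arguments cwtape {Q}.
Arguments cctape {Q}.

Definition read_tape (s : seq bool) (h : nat) : option bool :=
  if (0 < h) && (h <= size s) then Some (nth false s h.-1) else None.

Definition write_tape (s : seq bool) (h : nat) (b : bool) : seq bool :=
  if (0 < h) && (h <= size s) then set_nth false s h.-1 b else s.

Definition move_head (len : nat) (h : nat) (m : move) : nat :=
  match m with
  | MoveL => h.-1
  | MoveS => h
  | MoveR => minn h.+1 len.+1
  end.

Definition step (M : machine) (x aux : seq bool) (c : config (mQ M))
  : config (mQ M) :=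
  if mhalt M (cstate c) is Some _ then c else
  let '(q', mi, ma, (bw, mw), (bc, mc)) :=
    mdelta M (cstate c) (read_tape x (cin c)) (read_tape aux (caux c))
             (read_tape (cwtape c) (cwork c)) (read_tape (cctape c) (ccat c)) in
  let w' := write_tape (cwtape c) (cwork c) bw in
  let t' := write_tape (cctape c) (ccat c) bc in
  Config q' (move_head (size x) (cin c) mi) (move_head (size aux) (caux c) ma)
         (move_head (size w') (cwork c) mw) (move_head (size t') (ccat c) mc)
         w' t'.

Definition init (M : machine) (wlen : nat) (tau : seq bool) : config (mQ M) :=
  Config (mq0 M) 0 0 0 0 (nseq wlen false) tau.

Definition run (M : machine) (x aux : seq bool) (wlen : nat) (tau : seq bool)
  (t : nat) : config (mQ M) :=
  iter t (step M x aux) (init M wlen tau).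

Definition halts_with (M : machine) (x aux : seq bool) (wlen : nat)
  (tau : seq bool) (t : nat) (b : bool) (tau' : seq bool) : bool :=
  let c := run M x aux wlen tau t in
  (mhalt M (cstate c) == Some b) && (cctape c == tau').

Definition halted_by (M : machine) (x aux : seq bool) (wlen : nat)
  (tau : seq bool) (t : nat) : bool :=
  mhalt M (cstate (run M x aux wlen tau t)) != None.

Definition hamming (s t : seq bool) : nat :=
  count (fun p => p.1 != p.2) (zip s t) + (maxn (size s) (size t) - minn (size s) (size t)).

Definition language := seq bool -> bool.

Definition AVG_LCL (L : language) : Prop :=
  exists (k : nat) (e : rat) (M : machine),
  forall x : seq bool,
    let n := size x in
    exists f : (n ^ k).-tuple bool -> seq bool,
      (forall tau : (n ^ k).-tuple bool,
          exists t, halts_with M x [::] (k * up_log 2 n) tau t (L x) (f tau))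
      /\ ((\sum_(tau : (n ^ k).-tuple bool) hamming tau (f tau))%:R
            / (2 ^ (n ^ k))%:R <= e)%R.

Definition BPP (L : language) : Prop :=
  exists (c : nat) (M : machine),
  forall x : seq bool,
    let T := size x ^ c + c in
    (forall r : T.-tuple bool, [exists t : 'I_T.+1, halted_by M x r T [::] t])
    /\ 2 * 2 ^ T <=
       3 * #|[set r : T.-tuple bool |
                [exists t : 'I_T.+1, halts_with M x r T [::] t (L x) [::]]]|.

(* Main.v *)
Require Import Defs.
From mathcomp Require Import all_boot all_order all_algebra.
From mathcomp Require Import zify.
From Stdlib Require Import FunctionalExtensionality.

(* Call an initial content tau good if it ends at Hamming distance at most d
   from its final content; for d = 6E, with E a bound on the expected distance,
   Markov's inequality makes all but a sixth of the tau good.  A configuration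
   determines the final content of the run through it, and a string of length P
   has at most (P + 1)^d neighbours at distance at most d, so a configuration is
   visited by polynomially many good tau, and at most once by each since the run
   halts.  There are 2^P * poly(n) configurations, hence good runs have
   polynomial length on average, and all but another sixth of the tau halt
   within a polynomial clock.  The BPP machine draws tau at random and runs the
   catalytic machine under such a clock. *)

Set Implicit Arguments.
Unset Strict Implicit.
Unset Printing Implicit Defensive.

(** * Machine fragments and their composition *)

(** [BPP] asks for an explicit machine over binary tapes that halts on every random string within
    one bound T, which is also the length of its work tape and of its random tape. The clock limit,
    the number of random bits and the length of the simulated work tape depend on the input length,
    so the machine must compute them itself; most of the development assembles it from small
    fragments with verified running times. Work space is as plentiful as time, so numbers are kept
    in unary, and comparing two of them is a single cell probe. The clock is (n + 2) raised to a
    constant exponent fixed by the number of states, k and E, hence known when the machine is built.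
    That exponent exists because the factor 2^P in the number of configurations cancels against the
    number of initial contents, while the simulated work tape, being logarithmic, contributes only
    polynomially many contents. *)

Definition action := (move * move * (bool * move))%type.

(** A fragment sees no catalytic tape, since that of the machine under construction is empty. An
    exit value comes together with the last action, so leaving costs no extra step and data reaches
    the next fragment through the finite control. *)
Record gadget (E : Type) := Gadget {
  gQ : finType;
  g0 : gQ;
  gdelta : gQ -> option bool -> option bool -> option bool -> (gQ + E) * action
}.

Definition prim E (f : option bool -> option bool -> option bool -> E * action)
  : gadget E :=
  @Gadget E unit tt (fun _ rx ra rw => (inr (f rx ra rw).1, (f rx ra rw).2)).

Definition bind (A : finType) E (G : gadget A) (F : A -> gadget E) : gadget E :=
  @Gadget E (gQ G + {a : A & gQ (F a)})%type (inl (g0 G))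
    (fun q rx ra rw => match q with
     | inl q1 => let d := gdelta q1 rx ra rw in
       (inl (match d.1 with
             | inl q' => inl q'
             | inr a => inr (Tagged (fun a => gQ (F a)) (g0 (F a)))
             end), d.2)
     | inr (existT a q2) => let d := gdelta q2 rx ra rw in
       (match d.1 with
        | inl q' => inl (inr (Tagged (fun a => gQ (F a)) q'))
        | inr e => inr e
        end, d.2)
     end).

Definition loopg (A : finType) E (F : A -> gadget (A + E)) (a0 : A) : gadget E :=
  @Gadget E {a : A & gQ (F a)} (Tagged (fun a => gQ (F a)) (g0 (F a0)))
    (fun q rx ra rw => let: existT a q1 := q in
       let d := gdelta q1 rx ra rw in
       (match d.1 with
        | inl q' => inl (Tagged (fun a => gQ (F a)) q')
        | inr (inl a') => inl (Tagged (fun a => gQ (F a)) (g0 (F a')))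
        | inr (inr e) => inr e
        end, d.2)).

Definition machine_of (G : gadget bool) : machine :=
  @Machine (gQ G + bool)%type (inl (g0 G))
    (fun q => if q is inr b then Some b else None)
    (fun q rx ra rw _ => match q with
     | inl q1 => let: (res, (mi, ma, (b, mw))) := gdelta q1 rx ra rw in
         (res, mi, ma, (b, mw), (false, MoveS))
     | inr _ => (q, MoveS, MoveS, (false, MoveS), (false, MoveS))
     end).

(* The work tape is a function of the 0-based cell index, which is one less
   than the head position reading it. *)
Record tst := TS { ti : nat; ta : nat; tw : nat; tt_ : nat -> bool }.

Definition updb (F : nat -> bool) (i : nat) (b : bool) : nat -> bool :=
  fun j => if j == i then b else F j.

(** * Timed execution of fragments and of their compositions *)

Section Semantics.
Variables (x r : seq bool) (len : nat).

Definition rdt (c : tst) : option bool :=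
  if (0 < tw c) && (tw c <= len) then Some (tt_ c (tw c).-1) else None.

Definition app_action (a : action) (c : tst) : tst :=
  let: (mi, ma, (b, mw)) := a in
  TS (move_head (size x) (ti c) mi) (move_head (size r) (ta c) ma)
     (move_head len (tw c) mw)
     (if (0 < tw c) && (tw c <= len) then updb (tt_ c) (tw c).-1 b else tt_ c).

Definition gd E (G : gadget E) (q : gQ G) (c : tst) :=
  gdelta q (read_tape x (ti c)) (read_tape r (ta c)) (rdt c).

Inductive runs E (G : gadget E) : gQ G -> tst -> E -> tst -> nat -> Prop :=
| runs_last q c e a : gd q c = (inr e, a) -> runs q c e (app_action a c) 1
| runs_more q q' c a e c' t : gd q c = (inl q', a) ->
    runs q' (app_action a c) e c' t -> runs q c e c' t.+1.

Definition reaches E (G : gadget E) (c : tst) (e : E) (c' : tst) (t : nat) :=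
  exists2 t', t' <= t & runs (g0 G) c e c' t'.

Lemma reaches_le E (G : gadget E) c e c' t t' :
  t <= t' -> reaches G c e c' t -> reaches G c e c' t'.
Proof. by move=> le_t [u le_u Hu]; exists u => //; apply: leq_trans le_t. Qed.

Lemma reaches_prim E f c (e : E) a :
  f (read_tape x (ti c)) (read_tape r (ta c)) (rdt c) = (e, a) ->
  reaches (prim f) c e (app_action a c) 1.
Proof. by move=> Hf; exists 1 => //; apply: runs_last; rewrite /gd /= Hf. Qed.

Lemma runs_bind_inr (A : finType) E (G : gadget A) (F : A -> gadget E) a
    (q : gQ (F a)) c e c' t :
  runs q c e c' t ->
  @runs E (bind G F) (inr (Tagged (fun a => gQ (F a)) q)) c e c' t.
Proof.
elim=> {q c e c' t} [q c e act Hd|q q' c act e c' t Hd _ IH].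
  by apply: runs_last; rewrite /gd /= -/(gd q c) Hd.
by apply: runs_more IH; rewrite /gd /= -/(gd q c) Hd.
Qed.

Lemma runs_bind (A : finType) E (G : gadget A) (F : A -> gadget E)
    (q : gQ G) c a c1 t1 e c2 t2 :
  runs q c a c1 t1 -> runs (g0 (F a)) c1 e c2 t2 ->
  @runs E (bind G F) (inl q) c e c2 (t1 + t2).
Proof.
move=> H1 H2; elim: H1 H2 => {q c a c1 t1} [q c a act Hd|q q' c act a c1 t1 Hd _ IH] H2.
  rewrite add1n.
  apply: (@runs_more E (bind G F) (inl q) (inr (Tagged (fun a => gQ (F a)) (g0 (F a)))) _ act).
    by rewrite /gd /= -/(gd q c) Hd.
  exact: runs_bind_inr.
rewrite addSn; apply: (@runs_more E (bind G F) (inl q) (inl q') _ act).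
  by rewrite /gd /= -/(gd q c) Hd.
exact: IH.
Qed.

Lemma reaches_bind (A : finType) E (G : gadget A) (F : A -> gadget E)
    c a c1 t1 e c2 t2 :
  reaches G c a c1 t1 -> reaches (F a) c1 e c2 t2 ->
  reaches (bind G F) c e c2 (t1 + t2).
Proof.
move=> [u1 l1 H1] [u2 l2 H2]; exists (u1 + u2); first exact: leq_add.
exact: runs_bind H1 H2.
Qed.

Lemma runs_loop_next (A : finType) E (F : A -> gadget (A + E)) a1 a
    (q : gQ (F a)) c a' c1 t1 e c2 t2 :
  runs q c (inl a') c1 t1 ->
  @runs E (loopg F a1) (Tagged (fun a => gQ (F a)) (g0 (F a'))) c1 e c2 t2 ->
  @runs E (loopg F a1) (Tagged (fun a => gQ (F a)) q) c e c2 (t1 + t2).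
Proof.
move Ee: (inl a') => e1 H1 H2.
elim: H1 Ee H2 => {q c e1 c1 t1} [q c e1 act Hd|q q' c act e1 c1 t1 Hd _ IH] Ee H2.
  by rewrite add1n; apply: runs_more H2; rewrite /gd /= -/(gd q c) Hd -Ee.
rewrite addSn; apply: (@runs_more E (loopg F a1) (Tagged (fun a => gQ (F a)) q)
           (Tagged (fun a => gQ (F a)) q') _ act).
  by rewrite /gd /= -/(gd q c) Hd.
exact: IH.
Qed.

Lemma runs_loop_exit (A : finType) E (F : A -> gadget (A + E)) a1 a
    (q : gQ (F a)) c c1 t1 e :
  runs q c (inr e) c1 t1 ->
  @runs E (loopg F a1) (Tagged (fun a => gQ (F a)) q) c e c1 t1.
Proof.
move Ee: (inr e) => e1 H1.
elim: H1 Ee => {q c e1 c1 t1} [q c e1 act Hd|q q' c act e1 c1 t1 Hd _ IH] Ee.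
  by apply: runs_last; rewrite /gd /= -/(gd q c) Hd -Ee.
apply: (@runs_more E (loopg F a1) (Tagged (fun a => gQ (F a)) q)
           (Tagged (fun a => gQ (F a)) q') _ act).
  by rewrite /gd /= -/(gd q c) Hd.
exact: IH.
Qed.

(** The last argument of [loopg] only selects the initial state; the transitions do not depend on
    it. Re-entering the body with a new value is therefore the same as starting a fresh loop
    there. *)
Lemma runs_loop_start (A : finType) E (F : A -> gadget (A + E)) a1 a2 q c e c' t :
  @runs E (loopg F a1) q c e c' t -> @runs E (loopg F a2) q c e c' t.
Proof.
by elim=> [{}q {}c {}e a Hd|{}q q' {}c a {}e {}c' {}t Hd _ IH];
  [exact: runs_last|exact: runs_more IH].
Qed.

Lemma reaches_loop_next (A : finType) E (F : A -> gadget (A + E)) a a' c c1 t1 e c2 t2 :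
  reaches (F a) c (inl a') c1 t1 -> reaches (loopg F a') c1 e c2 t2 ->
  reaches (loopg F a) c e c2 (t1 + t2).
Proof.
move=> [u1 l1 H1] [u2 l2 H2]; exists (u1 + u2); first exact: leq_add.
by apply: runs_loop_next H1 _; exact: runs_loop_start H2.
Qed.

Lemma reaches_loop_exit (A : finType) E (F : A -> gadget (A + E)) a c c1 t1 e :
  reaches (F a) c (inr e) c1 t1 -> reaches (loopg F a) c e c1 t1.
Proof. by move=> [u1 l1 H1]; exists u1 => //; exact: runs_loop_exit. Qed.

Definition represents (c : tst) (q : Type) (d : config q) :=
  [/\ cin d = ti c, caux d = ta c, cwork d = tw c,
      size (cwtape d) = len /\ (forall i, i < len -> nth false (cwtape d) i = tt_ c i)
    & ccat d = 0 /\ cctape d = [::]].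

Lemma machine_of_step (G : gadget bool) (q : gQ G) c a res
    (d : config (mQ (machine_of G))) :
  represents c d -> cstate d = inl q -> gd q c = (res, a) ->
  represents (app_action a c) (step (machine_of G) x r d)
  /\ cstate (step (machine_of G) x r d) = res.
Proof.
case: d => s di da dw dc wt ct [/= -> -> -> [sz Hwt] [-> ->]] -> Hd.
have rdE : read_tape wt (tw c) = rdt c.
  rewrite /read_tape /rdt sz; case: ifP => // /andP[h1 h2]; rewrite Hwt //.
  by rewrite prednK.
rewrite /step /= rdE -/(gd q c) Hd.
case: a Hd => [[mi ma] [b mw]] Hd /=.
split=> //; split=> //=.
- rewrite /write_tape sz; case: ifP => [/andP[h1 h2]|_]; last by rewrite sz.
  by rewrite size_set_nth sz; congr move_head; lia.
- rewrite /write_tape sz; case: ifP => [/andP[h1 h2]|//].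
  split=> [|i li]; first by rewrite size_set_nth sz; lia.
  by rewrite nth_set_nth /= /updb Hwt //; case: eqP.
Qed.

Lemma machine_of_runs (G : gadget bool) (q : gQ G) c e c' t
    (d : config (mQ (machine_of G))) :
  runs q c e c' t -> represents c d -> cstate d = inl q ->
  represents c' (iter t (step (machine_of G) x r) d)
  /\ cstate (iter t (step (machine_of G) x r) d) = inr e.
Proof.
move=> H; elim: H d => {q c e c' t} [q c e a Hd|q q' c a e c' t Hd _ IH] d Hr Hs.
  exact: machine_of_step Hr Hs Hd.
have [Hr' Hs'] := machine_of_step Hr Hs Hd.
by rewrite iterSr; apply: IH.
Qed.

End Semantics.

Lemma machine_of_reaches (G : gadget bool) x r len e c' T :
  reaches x r len G (TS 0 0 0 (fun=> false)) e c' T ->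
  exists2 t, t <= T & halts_with (machine_of G) x r len [::] t e [::].
Proof.
move=> [t lt Hr]; exists t => //.
have H0 : represents len (TS 0 0 0 (fun=> false)) (init (machine_of G) len [::]).
  split=> //=; split=> [|i li]; first by rewrite size_nseq.
  by rewrite nth_nseq li.
have [[_ _ _ _ [_ Hct]] Hs] := machine_of_runs Hr H0 erefl.
by rewrite /halts_with /run Hs Hct !eqxx.
Qed.

(** * Counters and bit arrays on one binary work tape *)

(** The cell is preserved by writing back the symbol read. The default [false] arises only on an end
    marker, where writing has no effect. *)
Definition prim_keep E (f : option bool -> option bool -> option bool -> E)
    (mi ma mw : move) : gadget E :=
  prim (fun rx ra rw => (f rx ra rw, (mi, ma, (odflt false rw, mw)))).

Definition ret E (e : E) : gadget E := prim_keep (fun _ _ _ => e) MoveS MoveS MoveS.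
Definition read_input := prim_keep (fun rx _ _ => rx) MoveS MoveS MoveS.
Definition read_aux := prim_keep (fun _ ra _ => ra) MoveS MoveS MoveS.
Definition read_work := prim_keep (fun _ _ rw => rw) MoveS MoveS MoveS.
Definition move_input m := prim_keep (fun _ _ _ => tt) m MoveS MoveS.
Definition move_aux m := prim_keep (fun _ _ _ => tt) MoveS m MoveS.
Definition move_work m := prim_keep (fun _ _ _ => tt) MoveS MoveS m.
Definition write_work (b : bool) : gadget unit :=
  prim (fun _ _ _ => (tt, (MoveS, MoveS, (b, MoveS)))).

Fixpoint rep (k : nat) (G : gadget unit) : gadget unit :=
  if k is k'.+1 then bind G (fun=> rep k' G) else ret tt.

Definition home : gadget unit :=
  loopg (fun _ : unit => bind read_work (fun o =>
    if o is Some _ then bind (move_work MoveL) (fun=> ret (inl tt))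
    else ret (inr tt))) tt.

(* The work tape carries 15 interleaved tracks: cell [15 * p + j] is position
   [p] of track [j].  Track [j < 13] holds a counter, as a single mark at
   position [ctr j]; tracks 13 and 14 are bit arrays. *)
Definition seek (i : nat) : gadget unit :=
  bind (rep i.+1 (move_work MoveR)) (fun=>
    loopg (fun _ : unit => bind read_work (fun o =>
      if o == Some true then ret (inr tt)
      else bind (rep 15 (move_work MoveR)) (fun=> ret (inl tt)))) tt).

Definition goto (i j : nat) : gadget unit :=
  bind (seek i) (fun=>
  bind (rep i (move_work MoveL)) (fun=> rep j (move_work MoveR))).

(** The probe looks at track [j] in the column marked by counter [i]. For a counter [j] this decides
    equality of the two counters; for an array [j] it reads the entry indexed by [i]. *)
Definition test (i j : nat) : gadget bool :=
  bind (goto i j) (fun=> bind read_work (fun o =>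
  bind home (fun=> ret (o == Some true)))).

Definition put (i j : nat) (b : bool) : gadget unit :=
  bind (goto i j) (fun=> bind (write_work b) (fun=> home)).

(** [G] only carries the head from the old mark to the place of the new one. *)
Definition setmark (j : nat) (G : gadget unit) : gadget unit :=
  bind (goto j j) (fun=> bind (write_work false) (fun=>
  bind G (fun=> bind (write_work true) (fun=> home)))).

Definition inc (j : nat) := setmark j (rep 15 (move_work MoveR)).
Definition dec (j : nat) := setmark j (rep 15 (move_work MoveL)).
Definition reset (j : nat) :=
  setmark j (bind home (fun=> rep j.+1 (move_work MoveR))).

Definition init_marks : gadget unit :=
  bind (rep 13 (bind (move_work MoveR) (fun=> write_work true))) (fun=> home).

Record astate := AS {
  inp : nat; aux : nat; ctr : nat -> nat; arr : nat -> nat -> bool }.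

Definition cell (s : astate) (j p : nat) : bool :=
  if j < 13 then p == ctr s j else arr s j p.

(** By convention the work head is back on the left marker between operations, so an abstract state
    need not record it. *)
Definition phys (s : astate) : tst :=
  TS (inp s) (aux s) 0 (fun i => cell s (i %% 15) (i %/ 15)).

Definition setc (s : astate) (j v : nat) : astate :=
  AS (inp s) (aux s) (fun k => if k == j then v else ctr s k) (arr s).
Definition seta (s : astate) (j p : nat) (b : bool) : astate :=
  AS (inp s) (aux s) (ctr s)
     (fun k => if k == j then updb (arr s k) p b else arr s k).
Definition seti (s : astate) (a : nat) : astate := AS a (aux s) (ctr s) (arr s).
Definition setx (s : astate) (a : nat) : astate := AS (inp s) a (ctr s) (arr s).

Lemma updb_id F i : updb F i (F i) = F.
Proof. by apply: functional_extensionality => j; rewrite /updb; case: eqP => // ->. Qed.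

(** * Head movements on the concrete work tape *)

Section Physical.
Variables (x r : seq bool) (len : nat).
Notation reaches := (reaches x r len).

Lemma reaches_keep E (f : _ -> _ -> _ -> E) mi ma mw a b h F :
  reaches (prim_keep f mi ma mw) (TS a b h F)
    (f (read_tape x a) (read_tape r b) (rdt len (TS a b h F)))
    (TS (move_head (size x) a mi) (move_head (size r) b ma)
        (move_head len h mw) F) 1.
Proof.
rewrite -[X in TS _ _ (move_head len h mw) X](_ :
  (if (0 < h) && (h <= len) then updb F h.-1 (odflt false (rdt len (TS a b h F))) else F) = F).
  by apply: (@reaches_prim _ _ _ _ _ (TS a b h F) _
    (mi, ma, (odflt false (rdt len (TS a b h F)), mw))).
rewrite /rdt /=; case Eh: (0 < h <= len) => //=; exact: updb_id.
Qed.

Lemma reaches_ret E (e : E) c : reaches (ret e) c e c 1.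
Proof. case: c => a b h F; exact: reaches_keep. Qed.

Lemma reaches_write b0 a b h F : 0 < h <= len ->
  reaches (write_work b0) (TS a b h F) tt (TS a b h (updb F h.-1 b0)) 1.
Proof.
move=> hh.
have := @reaches_prim x r len _ (fun _ _ _ => (tt, (MoveS, MoveS, (b0, MoveS))))
  (TS a b h F) _ _ erefl.
by rewrite /= hh.
Qed.

Lemma reaches_read_work a b h F : 0 < h <= len ->
  reaches read_work (TS a b h F) (Some (F h.-1)) (TS a b h F) 1.
Proof.
move=> hh; have := reaches_keep (fun _ _ rw => rw) MoveS MoveS MoveS a b h F.
by rewrite /rdt /= hh.
Qed.

Lemma reaches_repR k a b h F : h + k <= len.+1 ->
  reaches (rep k (move_work MoveR)) (TS a b h F) tt (TS a b (h + k) F) k.+1.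
Proof.
elim: k h => [|k IH] h hk; first by rewrite addn0; apply: reaches_ret.
rewrite -[k.+2]add1n /=; apply: (reaches_bind (c1 := TS a b h.+1 F)).
  have -> : h.+1 = move_head len h MoveR by rewrite /=; lia.
  exact: reaches_keep.
by rewrite addnS -addSn; apply: IH; lia.
Qed.

Lemma reaches_repL k a b h F :
  reaches (rep k (move_work MoveL)) (TS a b h F) tt (TS a b (h - k) F) k.+1.
Proof.
elim: k h => [|k IH] h; first by rewrite subn0; apply: reaches_ret.
rewrite -[k.+2]add1n /=; apply: (reaches_bind (c1 := TS a b h.-1 F)).
  exact: reaches_keep.
by have -> : h - k.+1 = h.-1 - k by lia.
Qed.

(** Both end markers read as [None]: from [len.+1] the walk would stop at once, and [h <= len]
    excludes this. *)
Lemma reaches_home a b h F : h <= len ->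
  reaches home (TS a b h F) tt (TS a b 0 F) (3 * h + 2).
Proof.
elim: h => [|h IH] hl.
  apply: reaches_loop_exit; apply: (reaches_bind (t1 := 1) (t2 := 1)).
    exact: reaches_keep.
  exact: reaches_ret.
have -> : 3 * h.+1 + 2 = 3 + (3 * h + 2) by lia.
apply: reaches_loop_next (IH (ltnW hl)).
apply: (reaches_bind (t1 := 1) (t2 := 2)); first by apply: reaches_read_work; lia.
rewrite /=; apply: (reaches_bind (t1 := 1) (t2 := 1)); first exact: reaches_keep.
exact: reaches_ret.
Qed.

Lemma reaches_seek i v a b F : (15 * v + i).+1 <= len ->
  F (15 * v + i) = true -> (forall p, p < v -> F (15 * p + i) = false) ->
  reaches (seek i) (TS a b 0 F) tt (TS a b (15 * v + i).+1 F) (i + 18 * v + 4).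
Proof.
move=> hl Fv Fp.
apply: (@reaches_le _ _ _ _ _ _ _ _ (i.+2 + (18 * v + 2))); first lia.
apply: (reaches_bind (c1 := TS a b (0 + i.+1) F)); first by apply: reaches_repR; lia.
rewrite (_ : 0 + i.+1 = (15 * 0 + i).+1); last lia.
suff H m p : p + m = v -> reaches
    (loopg (fun _ : unit => bind read_work (fun o =>
      if o == Some true then ret (inr tt)
      else bind (rep 15 (move_work MoveR)) (fun=> ret (inl tt)))) tt)
    (TS a b (15 * p + i).+1 F) tt (TS a b (15 * v + i).+1 F) (18 * m + 2).
  exact: H.
elim: m p => [|m IH] p pv.
  have -> : p = v by lia.
  rewrite muln0 add0n; apply: reaches_loop_exit; apply: (reaches_bind (t1 := 1) (t2 := 1)).
    by apply: reaches_read_work; lia.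
  by rewrite /= Fv; apply: reaches_ret.
(* Each column costs 18 steps: one read, sixteen for the fifteen moves and their final [ret], and
   one to return to the loop. *)
have -> : 18 * m.+1 + 2 = 18 + (18 * m + 2) by lia.
have pv' : p < v by lia.
apply: (reaches_loop_next (a' := tt) (c1 := TS a b (15 * p.+1 + i).+1 F)); last by apply: IH; lia.
apply: (reaches_bind (t1 := 1) (t2 := 17)); first by apply: reaches_read_work; lia.
rewrite /= Fp //=; apply: (reaches_bind (t1 := 16) (t2 := 1)); last exact: reaches_ret.
have -> : (15 * p.+1 + i).+1 = (15 * p + i).+1 + 15 by lia.
by apply: reaches_repR; lia.
Qed.

Lemma reaches_goto i j v a b F : i < 15 -> j < 15 -> 15 * v + 15 <= len ->
  F (15 * v + i) = true -> (forall p, p < v -> F (15 * p + i) = false) ->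
  reaches (goto i j) (TS a b 0 F) tt (TS a b (15 * v + j).+1 F) (18 * v + 50).
Proof.
move=> hi hj hl Fv Fp.
apply: (@reaches_le _ _ _ _ _ _ _ _ ((i + 18 * v + 4) + (i.+1 + j.+1))); first lia.
apply: (reaches_bind (c1 := TS a b (15 * v + i).+1 F)); first by apply: reaches_seek => //; lia.
apply: (reaches_bind (c1 := TS a b (15 * v).+1 F)).
  have -> : (15 * v).+1 = (15 * v + i).+1 - i by lia.
  exact: reaches_repL.
rewrite -addSn; apply: reaches_repR; lia.
Qed.

End Physical.

Lemma track_eq i p j : j < 15 -> (i == 15 * p + j) = (i %/ 15 == p) && (i %% 15 == j).
Proof. by move=> hj; apply/idP/andP => [/eqP->|[/eqP<- /eqP<-]]; [split|]; lia. Qed.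

Lemma track_div p j : j < 15 -> (15 * p + j) %/ 15 = p.
Proof. lia. Qed.
Lemma track_mod p j : j < 15 -> (15 * p + j) %% 15 = j.
Proof. lia. Qed.
Definition trackE := (track_div, track_mod).

(** * Timed weakest preconditions on abstract states *)

Section Abstract.
Variables (x r : seq bool) (len N : nat).
Hypothesis len_ge : 15 * (N + 2) <= len.
Notation reaches := (reaches x r len).

(** A coarse bound for every basic operation, each being a few sweeps over about 15 * N cells.
    Counting time in this unit makes costs independent of the positions of marks. *)
Definition unit_cost := 200 * (N + 2).

Definition ok (s : astate) := forall j, ctr s j <= N.

(** Total correctness with a time bound. The invariant [ok] is assumed and re-established here, so
    that specifications need not carry it. *)
Definition wp E (G : gadget E) (t : nat) (Q : E -> astate -> Prop) (s : astate) :=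
  ok s -> exists e s', [/\ reaches G (phys s) e (phys s') (t * unit_cost), ok s' & Q e s'].

Lemma wp_le E (G : gadget E) t t' (Q Q' : E -> astate -> Prop) s :
  wp G t Q s -> t <= t' -> (forall e s', Q e s' -> Q' e s') -> wp G t' Q' s.
Proof.
move=> H le_t HQ /H[e [s' [Hr Hok Hq]]]; exists e, s'; split; [|by []|exact: HQ].
by apply: reaches_le Hr; rewrite leq_mul2r le_t orbT.
Qed.

Lemma wp_bind (A : finType) E (G : gadget A) (F : A -> gadget E) t1 t2 Q s :
  wp G t1 (fun a s1 => wp (F a) t2 Q s1) s -> wp (bind G F) (t1 + t2) Q s.
Proof.
move=> H /H[a [s1 [H1 ok1 H2]]]; have [e [s2 [H3 ok2 HQ]]] := H2 ok1.
exists e, s2; split=> //; rewrite mulnDl; exact: reaches_bind H1 H3.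
Qed.

Lemma wp_reaches E (G : gadget E) (Q : E -> astate -> Prop) s e s' t : t <= unit_cost ->
  (ok s -> reaches G (phys s) e (phys s') t) -> (ok s -> ok s') -> Q e s' -> wp G 1 Q s.
Proof.
move=> le_t H Hok HQ oks; exists e, s'; split; [|exact: Hok|by []].
by rewrite mul1n; apply: reaches_le (H oks).
Qed.

Lemma wp_reaches1 E (G : gadget E) (Q : E -> astate -> Prop) s e s' :
  reaches G (phys s) e (phys s') 1 -> (ok s -> ok s') -> Q e s' -> wp G 1 Q s.
Proof. by move=> H; apply: (@wp_reaches _ _ _ _ _ _ 1); rewrite // /unit_cost; lia. Qed.

Lemma wp_ret E (e : E) (Q : E -> astate -> Prop) s : Q e s -> wp (ret e) 1 Q s.
Proof.
by move=> HQ; apply: wp_reaches1 HQ => //; exact: reaches_ret.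
Qed.

Lemma wp_read_input (Q : option bool -> astate -> Prop) s :
  Q (read_tape x (inp s)) s -> wp read_input 1 Q s.
Proof.
by move=> HQ; apply: wp_reaches1 HQ => //; exact: reaches_keep.
Qed.

Lemma wp_read_aux (Q : option bool -> astate -> Prop) s :
  Q (read_tape r (aux s)) s -> wp read_aux 1 Q s.
Proof.
by move=> HQ; apply: wp_reaches1 HQ => //; exact: reaches_keep.
Qed.

Lemma wp_move_input m (Q : unit -> astate -> Prop) s :
  Q tt (seti s (move_head (size x) (inp s) m)) -> wp (move_input m) 1 Q s.
Proof.
by move=> HQ; apply: wp_reaches1 HQ => //; exact: reaches_keep.
Qed.

Lemma wp_move_aux m (Q : unit -> astate -> Prop) s :
  Q tt (setx s (move_head (size r) (aux s) m)) -> wp (move_aux m) 1 Q s.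
Proof.
by move=> HQ; apply: wp_reaches1 HQ => //; exact: reaches_keep.
Qed.

Lemma reaches_goto_phys i j s : i < 13 -> j < 15 -> ok s ->
  reaches (goto i j) (phys s) tt
    (TS (inp s) (aux s) (15 * ctr s i + j).+1 (tt_ (phys s))) (18 * N + 50).
Proof.
move=> hi hj oks; have := oks i => hc.
apply: (@reaches_le _ _ _ _ _ _ _ _ (18 * ctr s i + 50)); first lia.
apply: reaches_goto => //; try lia.
  by rewrite trackE /=; [rewrite trackE /cell ?hi //; lia|lia].
by move=> p hp; rewrite !trackE /cell ?hi //; lia.
Qed.

Lemma wp_test i j (Q : bool -> astate -> Prop) s : i < 13 -> j < 15 ->
  Q (cell s j (ctr s i)) s -> wp (test i j) 1 Q s.
Proof.
move=> hi hj.
apply: (@wp_reaches _ _ _ _ _ s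
  ((18 * N + 50) + (1 + ((3 * (15 * N + 15) + 2) + 1)))); [rewrite /unit_cost; lia| |by []].
move=> oks; have := oks i => hc.
apply: reaches_bind; first exact: reaches_goto_phys.
apply: reaches_bind; first by apply: reaches_read_work; lia.
rewrite /= !trackE //; apply: reaches_bind.
  by apply: reaches_le (reaches_home _ _ _ _ _ _); lia.
by case: (cell _ _ _); apply: reaches_ret.
Qed.

Lemma wp_put i j b (Q : unit -> astate -> Prop) s : i < 13 -> 13 <= j < 15 ->
  Q tt (seta s j (ctr s i) b) -> wp (put i j b) 1 Q s.
Proof.
move=> hi /andP[hj1 hj2].
apply: (@wp_reaches _ _ _ _ _ _
  ((18 * N + 50) + (1 + (3 * (15 * N + 15) + 2)))); [rewrite /unit_cost; lia| |by []].
move=> oks; have := oks i => hc.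
apply: reaches_bind; first exact: reaches_goto_phys.
apply: reaches_bind; first by apply: reaches_write; lia.
rewrite /=; set F := (X in TS _ _ _ X).
have -> : phys (seta s j (ctr s i) b) = TS (inp s) (aux s) 0 F.
  rewrite /phys /=; congr TS; apply: functional_extensionality => k.
  rewrite /F /updb track_eq // /cell /=.
  case: (k %% 15 =P j) => [->|]; last by rewrite andbF.
  by rewrite /updb ltnNge hj1 /= andbT.
by apply: reaches_le (reaches_home _ _ _ _ _ _); lia.
Qed.

Lemma wp_setmark j v G t (Q : unit -> astate -> Prop) s : j < 13 -> v <= N ->
  t <= 60 * N + 70 ->
  (forall F, ctr s j <= N ->
    reaches G (TS (inp s) (aux s) (15 * ctr s j + j).+1 F) tt
              (TS (inp s) (aux s) (15 * v + j).+1 F) t) ->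
  Q tt (setc s j v) -> wp (setmark j G) 1 Q s.
Proof.
move=> hj hv ht HG.
have hj15 : j < 15 by lia.
apply: (@wp_reaches _ _ _ _ _ _
  ((18 * N + 50) + (1 + (t + (1 + (3 * (15 * v + 15) + 2)))))).
- rewrite /unit_cost; lia.
- move=> oks; have := oks j => hc.
  apply: reaches_bind; first by apply: reaches_goto_phys.
  apply: reaches_bind; first by apply: reaches_write; lia.
  apply: reaches_bind; first exact: HG.
  apply: reaches_bind; first by apply: reaches_write; lia.
  rewrite /=; set F := (X in TS _ _ _ X).
  have -> : phys (setc s j v) = TS (inp s) (aux s) 0 F.
    rewrite /phys /=; congr TS; apply: functional_extensionality => k.
    rewrite /F /updb !track_eq // /cell /=.
    case: (k %% 15 =P j) => [->|]; last by rewrite !andbF.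
    by rewrite hj /= !andbT; case: (_ == v) => //; case: ifP => // /eqP ->.
  by apply: reaches_le (reaches_home _ _ _ _ _ _); lia.
- by move=> oks k; rewrite /setc /=; case: eqP.
Qed.

Lemma wp_inc j (Q : unit -> astate -> Prop) s : j < 13 -> ctr s j < N ->
  Q tt (setc s j (ctr s j).+1) -> wp (inc j) 1 Q s.
Proof.
move=> hj hN; apply: (@wp_setmark _ _ _ 16) => //; first lia.
move=> F _; have -> : (15 * (ctr s j).+1 + j).+1 = (15 * ctr s j + j).+1 + 15 by lia.
by apply: reaches_repR; lia.
Qed.

Lemma wp_dec j (Q : unit -> astate -> Prop) s : j < 13 -> 0 < ctr s j <= N ->
  Q tt (setc s j (ctr s j).-1) -> wp (dec j) 1 Q s.
Proof.
move=> hj hN; apply: (@wp_setmark _ _ _ 16) => //; try lia.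
move=> F _; have -> : (15 * (ctr s j).-1 + j).+1 = (15 * ctr s j + j).+1 - 15 by lia.
exact: reaches_repL.
Qed.

Lemma wp_reset j (Q : unit -> astate -> Prop) s : j < 13 ->
  Q tt (setc s j 0) -> wp (reset j) 1 Q s.
Proof.
move=> hj; apply: (@wp_setmark _ _ _ ((3 * (15 * N + 15) + 2) + j.+2)) => //; first lia.
move=> F hc; apply: reaches_bind.
  by apply: reaches_le (reaches_home _ _ _ _ _ _); lia.
by rewrite -[(_ + j).+1]add0n; apply: reaches_repR; lia.
Qed.

Definition astate0 := AS 0 0 (fun=> 0) (fun _ _ => false).

Lemma reaches_init_marks :
  reaches init_marks (TS 0 0 0 (fun=> false)) tt (phys astate0) unit_cost.
Proof.
apply: (@reaches_le _ _ _ _ _ _ _ _ ((2 * 13 + 1) + (3 * 13 + 2))).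
  by rewrite /unit_cost; lia.
have H k h : h + k <= len ->
    reaches (rep k (bind (move_work MoveR) (fun=> write_work true)))
      (TS 0 0 h (fun i => i < h)) tt (TS 0 0 (h + k) (fun i => i < h + k)) (2 * k + 1).
  elim: k h => [|k IH] h hk; first by rewrite addn0; apply: reaches_ret.
  have -> : 2 * k.+1 + 1 = (1 + 1) + (2 * k + 1) by lia.
  rewrite -addSnnS; apply: (reaches_bind (c1 := TS 0 0 h.+1 (fun i => i < h.+1))); last by apply: IH; lia.
  apply: (reaches_bind (c1 := TS 0 0 h.+1 (fun i => i < h))).
    have {1}-> : h.+1 = move_head len h MoveR by rewrite /=; lia.
    exact: reaches_keep.
  have -> : (fun i => i < h.+1) = updb (fun i => i < h) h true.
    by apply: functional_extensionality => i; rewrite /updb; case: eqP; lia.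
  by apply: (@reaches_write _ _ _ _ _ _ h.+1); lia.
apply: (reaches_bind (c1 := TS 0 0 13 (fun i => i < 13))).
  by apply: (H 13 0); lia.
have -> : phys astate0 = TS 0 0 0 (fun i => i < 13).
  rewrite /phys /=; congr TS; apply: functional_extensionality => i.
  by rewrite /cell /=; case: ifP; lia.
by apply: reaches_home; lia.
Qed.

Lemma wp_loop (A : finType) E (F : A -> gadget (A + E)) a t1 t2
    (Q : E -> astate -> Prop) s :
  wp (F a) t1 (fun e s1 => match e with
    | inl a' => wp (loopg F a') t2 Q s1
    | inr e' => Q e' s1
    end) s -> wp (loopg F a) (t1 + t2) Q s.
Proof.
move=> H /H[[a'|e] [s1 [H1 ok1 HQ]]].
  have [e [s2 [H2 ok2 {}HQ]]] := HQ ok1; exists e, s2; split=> //.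
  by rewrite mulnDl; apply: reaches_loop_next H1 H2.
exists e, s1; split=> //; apply: reaches_loop_exit; apply: reaches_le H1.
by rewrite leq_mul2r leq_addr orbT.
Qed.

Definition for_ (i lim : nat) (body : gadget unit) : gadget unit :=
  bind (reset i) (fun=> loopg (fun _ : unit => bind (test i lim) (fun b =>
    if b then ret (inr tt)
    else bind body (fun=> bind (inc i) (fun=> ret (inl tt))))) tt).

(** The body is asked for the invariant of the state that the coming increment will produce. A round
    adds 3 units to the body (test, increment, return); the remaining 3 pay for the reset, the last
    test and the exit. *)
Lemma wp_for i lim (body : gadget unit) t L (I : nat -> astate -> Prop)
    (Q : unit -> astate -> Prop) s :
  i < 13 -> lim < 13 -> L <= N ->
  (forall v s, v <= L -> I v s -> ctr s i = v /\ ctr s lim = L) ->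
  (forall v s, v < L -> I v s ->
     wp body t (fun _ s' => ctr s' i = v /\ I v.+1 (setc s' i v.+1)) s) ->
  (forall s, I L s -> Q tt s) ->
  I 0 (setc s i 0) ->
  wp (for_ i lim body) (3 + L * (t + 3)) Q s.
Proof.
move=> hi hlim hL HI Hbody HQ I0.
rewrite (_ : 3 + _ = 1 + (L * (t + 3) + 2)); last lia.
apply: wp_bind; apply: wp_reset => //.
suff H m v s' : v + m = L -> I v s' -> wp
    (loopg (fun _ : unit => bind (test i lim) (fun b =>
       if b then ret (inr tt)
       else bind body (fun=> bind (inc i) (fun=> ret (inl tt))))) tt)
    (m * (t + 3) + 2) Q s'.
  exact: H I0.
elim: m v s' => {s I0} [|m IH] v s Em Iv; have [E1 E2] := HI v s ltac:(lia) Iv.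
  have Ev : v = L by lia.
  rewrite mul0n -[0 + 2]/((1 + 1) + 0); apply: wp_loop; apply: wp_bind.
  apply: wp_test => //; first lia.
  rewrite /cell hlim E1 E2 Ev eqxx; apply: wp_ret.
  by apply: HQ; rewrite -Ev.
have vL : v < L by lia.
rewrite (_ : m.+1 * (t + 3) + 2 = 1 + (t + (1 + 1)) + (m * (t + 3) + 2)); last lia.
apply: wp_loop; apply: wp_bind; apply: wp_test => //; first lia.
rewrite /cell hlim E1 E2 ltn_eqF //.
apply: wp_bind; apply: wp_le (Hbody _ _ vL Iv) (leqnn _) _ => _ s' [E3 I'].
apply: wp_bind; apply: wp_inc => //; first by rewrite E3; lia.
rewrite E3; apply: wp_ret; apply: IH I'; lia.
Qed.

Lemma wp_ok E (G : gadget E) t (Q : E -> astate -> Prop) s :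
  (ok s -> wp G t Q s) -> wp G t Q s.
Proof. by move=> H oks; apply: H. Qed.

End Abstract.

(** * Arithmetic on counters *)

(* Counters 0, 1 and 2 are scratch registers of the arithmetic routines. *)
Definition add (dst src : nat) := for_ 0 src (inc dst).
Definition copy (dst src : nat) := bind (reset dst) (fun=> add dst src).
(** The product is accumulated in counter 2 because [dst] is itself the summand of every round. *)
Definition mulby (dst b : nat) :=
  bind (reset 2) (fun=> bind (for_ 1 b (add 2 dst)) (fun=> copy dst 2)).
(** The exponent is a constant of the machine, so the multiplications are unrolled in the finite
    control. *)
Definition pow (dst b e : nat) :=
  bind (reset dst) (fun=> bind (inc dst) (fun=> rep e (mulby dst b))).

(** Equality up to the scratch counters, whose values after an arithmetic routine are left
    unspecified. *)
Definition sim (s s' : astate) :=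
  [/\ inp s' = inp s, aux s' = aux s, arr s' = arr s
    & forall j, 3 <= j -> ctr s' j = ctr s j].

Lemma sim_trans s1 s2 s3 : sim s1 s2 -> sim s2 s3 -> sim s1 s3.
Proof.
by move=> [e1 e2 e3 H1] [f1 f2 f3 H2]; split=> [|||j hj]; rewrite ?f1 ?f2 ?f3 ?H2 ?H1.
Qed.

Lemma sim_setc s s' j v : sim s s' -> sim (setc s j v) (setc s' j v).
Proof. by move=> [e1 e2 e3 H]; split=> //= k hk; rewrite H. Qed.

Lemma sim_scratch s s' j v : sim s s' -> j < 3 -> sim s (setc s' j v).
Proof.
by move=> [e1 e2 e3 H] hj; split=> //= k hk; rewrite gtn_eqF ?H //; exact: leq_trans hk.
Qed.

Lemma setcK s j v : ctr s j = v -> setc s j v = s.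
Proof.
move=> <-; case: s => a b c d; rewrite /setc /=; congr AS.
by apply: functional_extensionality => k; case: eqP => // ->.
Qed.

Lemma setc_setc s j v w : setc (setc s j v) j w = setc s j w.
Proof.
by rewrite /setc /=; congr AS; apply: functional_extensionality => k; case: eqP.
Qed.

Section Arithmetic.
Variables (x r : seq bool) (len N : nat).
Hypothesis len_ge : 15 * (N + 2) <= len.
Notation wp := (@wp x r len N _).

Lemma wp_add dst src (Q : unit -> astate -> Prop) s :
  0 < dst < 13 -> 0 < src < 13 -> dst != src -> ctr s dst + ctr s src <= N ->
  Q tt (setc (setc s dst (ctr s dst + ctr s src)) 0 (ctr s src)) ->
  wp (add dst src) (4 * N + 3) Q s.
Proof.
move=> hd hs hds hN HQ.
apply: (@wp_le _ _ _ _ _ _ (3 + ctr s src * (1 + 3)) _ Q) => //; last lia.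
apply: (wp_for len_ge (I := fun v s' =>
  s' = setc (setc s dst (ctr s dst + v)) 0 v)) => //; try lia.
- move=> v _ hv -> /=; split=> //.
  by rewrite gtn_eqF; [rewrite eq_sym (negPf hds)|lia].
- move=> v _ hv ->; apply: wp_inc => //; first lia.
    by rewrite /= gtn_eqF ?eqxx; lia.
  have d0 : (dst == 0) = false by lia.
  split; first by rewrite /= eq_sym d0.
  rewrite /setc /=; congr AS; apply: functional_extensionality => k.
  by case: (k =P 0) => // _; case: (k =P dst) => // _; rewrite d0 eqxx addnS.
- by move=> _ ->.
- by rewrite addn0 [setc s dst _]setcK.
Qed.

Lemma wp_copy dst src (Q : unit -> astate -> Prop) s :
  0 < dst < 13 -> 0 < src < 13 -> dst != src -> ctr s src <= N ->
  Q tt (setc (setc s dst (ctr s src)) 0 (ctr s src)) ->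
  wp (copy dst src) (4 * N + 4) Q s.
Proof.
move=> hd hs hds hN HQ; rewrite -[4 * N + 4]/(4 * N + (3 + 1)) addnA addnC.
apply: wp_bind; apply: wp_reset => //; first lia.
have E : ctr (setc s dst 0) src = ctr s src by rewrite /= eq_sym (negPf hds).
by apply: wp_add; rewrite // !E /= eqxx // setc_setc.
Qed.

Definition mul_cost := N * (4 * N + 6) + 4 * N + 8.

Lemma wp_mulby dst b (Q : unit -> astate -> Prop) s :
  2 < dst < 13 -> 2 < b < 13 -> ctr s dst * ctr s b <= N ->
  (forall s', sim (setc s dst (ctr s dst * ctr s b)) s' -> Q tt s') ->
  wp (mulby dst b) mul_cost Q s.
Proof.
move=> hd hb hN HQ; apply: wp_ok => oks.
apply: (@wp_le _ _ _ _ _ _ (1 + ((3 + ctr s b * ((4 * N + 3) + 3)) + (4 * N + 4))) _ Q) => //.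
  2: by have := leq_mul (oks b) (leqnn (4 * N + 6)); rewrite /mul_cost; lia.
apply: wp_bind; apply: wp_reset => //.
apply: wp_bind.
apply: (wp_for len_ge (I := fun v s' =>
  [/\ sim s s', ctr s' 1 = v & ctr s' 2 = ctr s dst * v])) => //; first lia.
- by move=> v s' _ [[_ _ _ Hs] -> _]; rewrite Hs; lia.
- move=> v s' hv [Hs E1 E2].
  have E3 : ctr s' dst = ctr s dst by case: Hs => _ _ _ ->; lia.
  have le1 : ctr s dst * v.+1 <= N by apply: leq_trans hN; rewrite leq_mul2l hv orbT.
  apply: wp_add => //; rewrite ?E2 ?E3; try lia.
  rewrite /= E1; split=> //; split=> //=.
    by do 3 apply: sim_scratch => //.
  by rewrite mulnS addnC.
- move=> s' [Hs E1 E2]; apply: wp_copy; rewrite ?E2; try lia.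
  by apply: HQ; apply: sim_scratch => //; apply: sim_setc.
- by split=> //=; [do 2 apply: sim_scratch => //|rewrite muln0].
Qed.

Lemma wp_rep e G t (I : nat -> astate -> Prop) (Q : unit -> astate -> Prop) s :
  (forall v s, v < e -> I v s -> wp G t (fun _ => I v.+1) s) ->
  (forall s, I e s -> Q tt s) -> I 0 s -> wp (rep e G) (e * t + 1) Q s.
Proof.
move=> HI HQ.
suff H m v s' : v + m = e -> I v s' -> wp (rep m G) (m * t + 1) Q s' by exact: H.
elim: m v s' => [|m IH] v s' Em Iv.
  by apply: wp_ret => //; apply: HQ; rewrite -Em addn0.
rewrite mulSn -addnA /=; apply: wp_bind.
have ve : v < e by lia.
apply: wp_le (HI _ _ ve Iv) (leqnn _) _ => -[] s1 I1.
by apply: IH I1; lia.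
Qed.

(** All intermediate powers must fit below [N], not just the last: for base 0 the initial value 1 is
    the largest. *)
Lemma wp_pow dst b e (Q : unit -> astate -> Prop) s :
  2 < dst < 13 -> 2 < b < 13 -> dst != b -> (forall j, j <= e -> ctr s b ^ j <= N) ->
  (forall s', sim (setc s dst (ctr s b ^ e)) s' -> Q tt s') ->
  wp (pow dst b e) (2 + (e * mul_cost + 1)) Q s.
Proof.
move=> hd hb hdb hN HQ; rewrite -[2]/(1 + 1) -addnA.
apply: wp_bind; apply: wp_reset => //; first lia.
have N0 : 0 < N by apply: (hN 0).
apply: wp_bind; apply: wp_inc => //; [lia|by rewrite /= eqxx|].
rewrite setc_setc /= eqxx.
apply: (wp_rep (I := fun v s' => sim (setc s dst (ctr s b ^ v)) s')) => //.
move=> v s' hv Hs; have [_ _ _ H] := Hs.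
have E1 : ctr s' dst = ctr s b ^ v by rewrite H /= ?eqxx; lia.
have E2 : ctr s' b = ctr s b by rewrite H /= 1?eq_sym ?(negPf hdb); lia.
apply: wp_mulby => //; rewrite E1 E2 -expnSr; first exact: hN.
move=> s2; apply: sim_trans; rewrite -(setc_setc s dst (ctr s b ^ v)).
exact: sim_setc.
Qed.

End Arithmetic.

(** * Lengths, clock and random content *)

Local Notation "G1 ;; G2" := (bind G1 (fun=> G2))
  (at level 100, right associativity, only parsing).

(** Both scans of the input move before they read, as each starts on an end marker that would stop
    it immediately. *)
Definition count_input : gadget unit :=
  loopg (fun _ : unit => move_input MoveR ;; bind read_input (fun o =>
    if o is Some _ then (inc 4 ;; ret (inl tt)) else ret (inr tt))) tt.

Definition rewind_input : gadget unit :=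
  loopg (fun _ : unit => move_input MoveL ;; bind read_input (fun o =>
    if o is Some _ then ret (inl tt) else ret (inr tt))) tt.

(* Counters: 3 loops and the clock; 4 holds [n], 5 [n + 2], 6 [n ^ k], 7
   [k * up_log 2 n], 9 the clock limit; 8 and 10 hold [2 ^ up_log 2 v] and
   [up_log 2 v] while 3 counts [v] up to [n]; then 10 and 11 are the simulated
   work and catalytic heads, arrays 13 and 14 their tapes.  Counters 6 and 7
   finally hold the positions of the right end markers.  Counter 12 stays 0. *)
Definition log_step : gadget unit :=
  bind (test 3 8) (fun b =>
    if b then (copy 2 8 ;; add 8 2 ;; inc 10) else ret tt).

Definition load_random_bit : gadget unit :=
  move_aux MoveR ;; inc 11 ;;
  bind read_aux (fun o => put 11 14 (o == Some true)).

Definition setup (k e : nat) : gadget unit :=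
  count_input ;; rewind_input ;; add 5 4 ;; inc 5 ;; inc 5 ;;
  pow 6 4 k ;;
  inc 8 ;; for_ 3 4 log_step ;; rep k (add 7 10) ;; reset 10 ;;
  pow 9 5 e ;;
  for_ 3 6 load_random_bit ;; reset 11 ;; inc 6 ;; inc 7 ;; reset 3.

Definition setup_cost (n k e N : nat) : nat :=
  5 * n + 3 + (3 * n + 3 + (4 * N + 3 + (1 + (1 +
  (2 + (k * mul_cost N + 1) +
  (1 + (3 + n * (1 + (4 * N + 4 + (4 * N + 3 + 1)) + 3) +
  (k * (4 * N + 3) + 1 + (1 +
  (2 + (e * mul_cost N + 1) +
  (3 + n ^ k * (1 + (1 + (1 + 1)) + 3) + (1 + (1 + (1 + 1)))))))))))))).

(** The logarithm grows exactly when v leaves a power of two, which [log_step] detects by comparing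
    counters 3 and 8. *)
Lemma up_log2_succ v :
  up_log 2 v.+1 = up_log 2 v + (v == 2 ^ up_log 2 v).
Proof.
case: v => [|v]; first by rewrite up_log1 up_log0.
have le_v : v.+1 <= 2 ^ up_log 2 v.+1 by apply: up_logP.
case: eqP => [Ev|ne]; rewrite ?addn1 ?addn0.
  by apply: up_log_eq => //; rewrite -Ev ltnSn expnS -Ev; lia.
apply/eqP; rewrite eqn_leq; apply/andP; split; last exact: leq_up_log.
apply: up_log_min => //.
by move/eqP: ne => ne; rewrite ltn_neqAle ne.
Qed.

Lemma up_log2_bound n : 2 ^ up_log 2 n <= 2 * n + 1.
Proof.
case: (leqP n 1) => [n1|n1].
  by case: n n1 => [|[|]] // _; rewrite ?up_log0 ?up_log1.
have := up_log_gtn (ltnSn 1) n1; have : 0 < up_log 2 n by rewrite up_log_gt0.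
by case: (up_log 2 n) => // u _ /=; rewrite expnS; lia.
Qed.

Lemma up_log2_leq n : up_log 2 n <= n.
Proof. by apply: up_log_min => //; apply: ltnW; apply: ltn_expl. Qed.

(** The leading zeros fill the scratch indices, which [sim] ignores; entry i of the list is counter
    i + 3. *)
Definition registers (l : seq nat) (j : nat) : nat := nth 0 [:: 0, 0, 0 & l] j.

Arguments registers l j /.

Lemma registers_setc a b l f j v s : 3 <= j ->
  sim (setc (AS a b (registers l) f) j v) s ->
  sim (AS a b (registers (set_nth 0 l (j - 3) v)) f) s.
Proof.
move=> hj; apply: sim_trans; split=> //= i hi.
case: i hi => [|[|[|i]]] // _; rewrite /registers /= nth_set_nth /=.
by have -> : (i == j - 3) = (i.+3 == j) by lia.
Qed.

(** Positions are head positions: bit p - 1 of the random string sits at p, and position 0 stands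
    for the left marker. *)
Definition cat_array (r : seq bool) (m j p : nat) : bool :=
  [&& j == 14, 0 < p <= m & nth false r p.-1].

Lemma pow_le_bound n e j : j <= e -> (n + 2) ^ j <= (n + 2) ^ e.
Proof. by move=> hj; rewrite leq_pexp2l // addn2. Qed.

Lemma leq_pow_add2 n k : n ^ k <= (n + 2) ^ k.
Proof. by case: k => // k; rewrite leq_exp2r // leq_addr. Qed.

(** * Fitting all quantities below the counter capacity *)

Section Bounds.
Variables (n k e : nat).
Hypothesis le_ke : k + 2 <= e.

(** The condition [k + 2 <= e] leaves two factors n + 2 beyond (n + 2)^k; they absorb additive
    constants and the logarithm. *)
Let mul_le_bound c d : c <= (n + 2) ^ k -> d <= (n + 2) ^ 2 -> c * d <= (n + 2) ^ e.
Proof.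
by move=> hc hd; apply: (leq_trans (leq_mul hc hd)); rewrite -expnD; apply: pow_le_bound.
Qed.

Let pow_gt0 : 0 < (n + 2) ^ k.
Proof. by rewrite expn_gt0 addn2. Qed.

Lemma lin_le_bound : 2 * n + 4 <= (n + 2) ^ e.
Proof. by rewrite -[2 * n + 4]mul1n; apply: mul_le_bound => //; nia. Qed.

Lemma pow_lt_bound : (n ^ k).+2 <= (n + 2) ^ e.
Proof.
have : (n + 2) ^ k * 4 <= (n + 2) ^ e by apply: mul_le_bound => //; nia.
have := leq_pow_add2 n k; lia.
Qed.

Lemma log_lt_bound : (k * up_log 2 n).+2 <= (n + 2) ^ e.
Proof.
have h1 : k < (n + 2) ^ k.
  apply: leq_trans (ltn_expl k (ltnSn 1)) _; rewrite -[2 in X in X <= _]/(0 + 2).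
  by case: (k) => // k'; rewrite leq_exp2r // leq_add2r.
have : k.+1 * (n + 2) <= (n + 2) ^ e by apply: mul_le_bound => //; nia.
have := leq_mul (leqnn k) (up_log2_leq n); nia.
Qed.

End Bounds.

Section Setup.
Variables (x r : seq bool) (len k e : nat).
Let n := size x.
Let N := (n + 2) ^ e.
Let l := up_log 2 n.
Hypothesis len_ge : 15 * (N + 2) <= len.
Hypothesis le_ke : k + 2 <= e.
Hypothesis le_r : n ^ k <= size r.
Notation wp := (@wp x r len N _).

Let st a b c := AS a b (registers c) (fun _ _ => false).

Let pow_le_N j : j <= e -> (n + 2) ^ j <= N := @pow_le_bound n e j.
Let N_ge_lin : 2 * n + 4 <= N := lin_le_bound n le_ke.
Let N_ge_pow : (n ^ k).+2 <= N := pow_lt_bound n le_ke.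
Let N_ge_log : (k * l).+2 <= N := log_lt_bound n le_ke.

Lemma wp_count_input m v (Q : unit -> astate -> Prop) s :
  v + m = n -> sim (st v 0 [:: 0; v; 0; 0; 0; 0; 0; 0; 0; 0]) s ->
  (forall s', sim (st n.+1 0 [:: 0; n; 0; 0; 0; 0; 0; 0; 0; 0]) s' -> Q tt s') ->
  wp count_input (5 * m + 3) Q s.
Proof.
elim: m v s => [|m IH] v s Em Hs HQ; have [Hi Hx Ha Hc] := Hs.
  rewrite (_ : 5 * 0 + 3 = (1 + (1 + 1)) + 0) //; apply: wp_loop.
  apply: wp_bind; apply: wp_move_input => //.
  apply: wp_bind; apply: wp_read_input => //=.
  rewrite Hi /= /read_tape -/n (_ : (_ && _) = false); last by lia.
  apply: wp_ret => //; apply: HQ; rewrite (_ : minn _ _ = n.+1); last lia.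
  by rewrite (_ : v = n) in Hs; [case: Hs => ????|lia].
rewrite (_ : 5 * m.+1 + 3 = (1 + (1 + (1 + 1))) + (5 * m + 3 + 1)); last lia.
apply: wp_loop; apply: wp_bind; apply: wp_move_input => //.
apply: wp_bind; apply: wp_read_input => //=.
rewrite Hi /= /read_tape -/n (_ : (_ && _) = true); last by lia.
apply: wp_bind; apply: wp_inc => //=; first by rewrite Hc //=; lia.
apply: wp_ret => //.
apply: wp_le (IH v.+1 _ _ _ HQ) _ _ => //; try lia.
rewrite (_ : minn _ _ = v.+1); last lia.
rewrite Hc //=; apply: (@registers_setc _ _ [:: 0; v; 0; 0; 0; 0; 0; 0; 0; 0] _ 4) => //.
by apply: sim_setc; case: Hs.
Qed.

Lemma wp_rewind_input m (Q : unit -> astate -> Prop) c s : m <= n ->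
  sim (st m.+1 0 c) s -> (forall s', sim (st 0 0 c) s' -> Q tt s') ->
  wp rewind_input (3 * m + 3) Q s.
Proof.
elim: m s => [|m IH] s hm Hs HQ; have [Hi Hx Ha Hc] := Hs.
  rewrite (_ : 3 * 0 + 3 = (1 + (1 + 1)) + 0) //; apply: wp_loop.
  apply: wp_bind; apply: wp_move_input => //.
  apply: wp_bind; apply: wp_read_input => //=.
  by rewrite Hi /=; apply: wp_ret => //; apply: HQ; case: Hs.
rewrite (_ : 3 * m.+1 + 3 = (1 + (1 + 1)) + (3 * m + 3)); last lia.
apply: wp_loop; apply: wp_bind; apply: wp_move_input => //.
apply: wp_bind; apply: wp_read_input => //=.
rewrite Hi /= /read_tape -/n hm; apply: wp_ret => //.
by apply: (IH _ (ltnW hm)) HQ; case: Hs.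
Qed.

Lemma wp_log_step v b P (Q : unit -> astate -> Prop) s : v < n ->
  sim (st 0 0 [:: v; n; b; P; 0; 2 ^ up_log 2 v; 0; up_log 2 v; 0; 0]) s ->
  (forall s', sim (st 0 0 [:: v; n; b; P; 0; 2 ^ up_log 2 v.+1; 0; up_log 2 v.+1; 0; 0]) s' ->
     Q tt s') ->
  wp log_step (1 + (4 * N + 4 + (4 * N + 3 + 1))) Q s.
Proof.
move=> hv Hs HQ; have [_ _ _ Hc] := Hs.
apply: wp_bind; apply: wp_test => //; rewrite /cell /= !Hc //=.
move: HQ; rewrite up_log2_succ; case: eqP => [Ev|_] HQ; last first.
  rewrite addn0 in HQ.
  by apply: (@wp_le _ _ _ _ _ _ 1 _ Q); [apply: wp_ret => //; apply: HQ|lia|].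
have [lv lm] : up_log 2 v <= v /\ 2 ^ up_log 2 v <= n.
  by split; [exact: up_log2_leq|rewrite -Ev ltnW].
apply: wp_bind; apply: wp_copy; rewrite //= !Hc //=; first lia.
apply: wp_bind; apply: wp_add; rewrite //= ?Hc //=; first lia.
apply: wp_inc; rewrite //= ?Hc //=; first lia.
apply: HQ; apply: (@registers_setc _ _ [:: v; n; b; P; 0; 2 ^ (up_log 2 v + true); 0; up_log 2 v; 0; 0] _ 10) => //.
rewrite addn1 expnS mul2n -addnn; apply: sim_setc; apply: sim_scratch => //.
apply: (@registers_setc _ _ [:: v; n; b; P; 0; 2 ^ up_log 2 v; 0; up_log 2 v; 0; 0] _ 8) => //.
by apply: sim_setc; do 2 apply: sim_scratch => //.
Qed.

Lemma wp_load_random_bit v c0 c1 c2 c3 c4 c5 c6 (Q : unit -> astate -> Prop) s :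
  v < n ^ k ->
  sim (AS 0 v (registers [:: v; c0; c1; c2; c3; c4; c5; c6; v; 0]) (cat_array r v)) s ->
  (forall s', sim (AS 0 v.+1 (registers [:: v; c0; c1; c2; c3; c4; c5; c6; v.+1; 0])
                      (cat_array r v.+1)) s' -> Q tt s') ->
  wp load_random_bit (1 + (1 + (1 + 1))) Q s.
Proof.
move=> hv Hs HQ; have [Hi Hx Ha Hc] := Hs; rewrite /= in Hi Hx Ha.
apply: wp_bind; apply: wp_move_aux => //.
apply: wp_bind; apply: wp_inc; rewrite //= ?Hc //=; first lia.
apply: wp_bind; apply: wp_read_aux => //=; apply: wp_put => //=.
(* The random head is not stopped by the right marker, as v < n^k <= size r. *)
apply: HQ; rewrite /seta /setc /= Hx (_ : minn _ _ = v.+1); last lia.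
split=> //=.
  rewrite Ha; apply: functional_extensionality => j; apply: functional_extensionality => p.
  rewrite /cat_array /read_tape /= (leq_trans hv le_r).
  case: (j =P 14) => //= _; rewrite /updb; case: (p =P v.+1) => [->|ne] /=.
    by rewrite leqnn; case: (nth _ _ _).
  by have -> : (p <= v.+1) = (p <= v) by lia.
move=> j hj; rewrite Hc //; case: (j =P 11) => [->//|].
by case: j hj => [|[|[|[|[|[|[|[|[|[|[|[|[|j]]]]]]]]]]]]].
Qed.

Lemma wp_setup (Q : unit -> astate -> Prop) :
  (forall s', sim (AS 0 (n ^ k) (registers [:: 0; n; n + 2; (n ^ k).+1; (k * l).+1;
                     2 ^ l; N; 0; 0; 0]) (cat_array r (n ^ k))) s' -> Q tt s') ->
  wp (setup k e) (setup_cost n k e N) Q astate0.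
Proof.
have Hl : 2 ^ l <= N by apply: leq_trans (up_log2_bound n) _; lia.
have Hll : l <= n := up_log2_leq n.
move=> HQ.
apply: wp_bind; apply: (@wp_count_input n 0) => //.
  by split=> //= j hj; rewrite -[_ :: _]/(nseq 13 0) nth_nseq if_same.
move=> s Hs; apply: wp_bind; apply: (wp_rewind_input (leqnn n) Hs) => {Hs}s Hs.
have [_ _ _ Hc] := Hs.
apply: wp_bind; apply: wp_add; rewrite //= ?Hc //=; first lia.
apply: wp_bind; apply: wp_inc; rewrite //= ?Hc //=; first lia.
apply: wp_bind; apply: wp_inc; rewrite //= ?Hc //=; first lia.
set s1 := setc _ 5 _.
have {Hs Hc}Hs : sim (st 0 0 [:: 0; n; n + 2; 0; 0; 0; 0; 0; 0; 0]) s1.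
  apply: (@registers_setc _ _ [:: 0; n; n.+1; 0; 0; 0; 0; 0; 0; 0] _ 5) => //.
  rewrite addn2; apply: sim_setc.
  apply: (@registers_setc _ _ [:: 0; n; n; 0; 0; 0; 0; 0; 0; 0] _ 5) => //.
  apply: sim_setc; apply: sim_scratch => //.
  by apply: (@registers_setc _ _ [:: 0; n; 0; 0; 0; 0; 0; 0; 0; 0] _ 5) => //; apply: sim_setc.
move: s1 Hs => {}s Hs; have [_ _ _ Hc] := Hs.
apply: wp_bind; apply: wp_pow => //.
  move=> j hj; rewrite Hc //=; apply: leq_trans (pow_le_N (j := j) _); last lia.
  by case: (j) => // j'; rewrite leq_exp2r //; lia.
move=> s'; rewrite Hc //= => /(sim_trans (sim_setc _ _ Hs)) {s Hs Hc} /registers_setc Hs.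
have {}Hs := Hs isT; rewrite /= in Hs; move: s' Hs => s Hs; have [_ _ _ Hc] := Hs.
apply: wp_bind; apply: wp_inc; rewrite //= ?Hc //=; first lia.
have {}Hs := registers_setc (j := 8) (v := 1) isT (sim_setc _ _ Hs).
apply: wp_bind.
apply: (wp_for len_ge (L := n) (I := fun v s => sim (st 0 0
  [:: v; n; n + 2; n ^ k; 0; 2 ^ up_log 2 v; 0; up_log 2 v; 0; 0]) s)) => //; first lia.
- by move=> v s' _ [_ _ _ H]; rewrite !H.
- move=> v s' hv Hs'; apply: (wp_log_step hv Hs') => s2 Hs2; split.
    by case: Hs2 => _ _ _ ->.
  exact: (registers_setc (j := 3) isT (sim_setc _ _ Hs2)).
- move=> {Hs Hc}s Hs2; apply: wp_bind.
  apply: (wp_rep len_ge (I := fun v s => sim (st 0 0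
    [:: n; n; n + 2; n ^ k; v * l; 2 ^ l; 0; l; 0; 0]) s)) => //.
    move=> v s' hv Hs'; have [_ _ _ H] := Hs'.
    apply: wp_add; rewrite //= ?H //=.
      by apply: leq_trans (ltnW (ltnW N_ge_log)); rewrite addnC -mulSn leq_mul2r hv orbT.
    apply: sim_scratch => //; rewrite mulSnr.
    exact: (registers_setc (j := 7) isT (sim_setc _ _ Hs')).
  move=> {Hs2}s Hs2; apply: wp_bind; apply: wp_reset => //.
  have {}Hs2 := registers_setc (j := 10) (v := 0) isT (sim_setc _ _ Hs2).
  rewrite /= in Hs2; have [_ _ _ Hc] := Hs2.
  apply: wp_bind; apply: wp_pow => //.
    by move=> j hj; rewrite Hc //=; apply: pow_le_N.
  move=> s'; rewrite Hc //= => /(sim_trans (sim_setc _ _ Hs2)) {s Hs2 Hc} /registers_setc Hs2.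
  have {}Hs2 := Hs2 isT; rewrite /= -/N in Hs2; apply: wp_bind.
  apply: (wp_for len_ge (L := n ^ k) (I := fun v s => sim (AS 0 v (registers
    [:: v; n; n + 2; n ^ k; k * l; 2 ^ l; N; 0; v; 0]) (cat_array r v)) s)) => //; first lia.
  + by move=> v s2 _ [_ _ _ H]; rewrite !H.
  + move=> v s2 hv Hs3; apply: (wp_load_random_bit hv Hs3) => s3 Hs4; split.
      by case: Hs4 => _ _ _ ->.
    exact: (registers_setc (j := 3) isT (sim_setc _ _ Hs4)).
  + move=> {Hs2 s'}s Hs2; apply: wp_bind; apply: wp_reset => //.
    have {}Hs2 := registers_setc (j := 11) (v := 0) isT (sim_setc _ _ Hs2).
    have [_ _ _ Hc] := Hs2.
    apply: wp_bind; apply: wp_inc => //; rewrite Hc //=; first lia.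
    have {Hc}Hs2 := registers_setc (j := 6) (v := (n ^ k).+1) isT (sim_setc _ _ Hs2).
    have [_ _ _ Hc] := Hs2.
    apply: wp_bind; apply: wp_inc => //; rewrite Hc //=; first lia.
    have {Hc}Hs2 := registers_setc (j := 7) (v := (k * l).+1) isT (sim_setc _ _ Hs2).
    apply: wp_reset => //; apply: HQ.
    exact: (registers_setc (j := 3) isT (sim_setc _ _ Hs2)).
  + have := registers_setc (j := 3) (v := 0) isT (sim_setc _ _ Hs2).
    apply: sim_trans; split=> //.
    apply: functional_extensionality => j; apply: functional_extensionality => p.
    by rewrite /cat_array /=; case: p => [|p]; rewrite ?andbF.
- exact: (registers_setc (j := 3) isT (sim_setc _ _ Hs)).
Qed.

End Setup.

(** * The simulation loop *)

(** Counter 12 is constantly 0 and [lim] is one past the simulated tape, so the two tests recognise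
    the end markers. *)
Definition read_head (h lim tr : nat) : gadget (option bool) :=
  bind (test h 12) (fun at0 => if at0 then ret None else
  bind (test h lim) (fun at_end => if at_end then ret None else
  bind (test h tr) (fun b => ret (Some b)))).

Definition write_head (h lim tr : nat) (b : bool) : gadget unit :=
  bind (test h 12) (fun at0 => if at0 then ret tt else
  bind (test h lim) (fun at_end => if at_end then ret tt else put h tr b)).

Definition shift_head (h lim : nat) (m : move) : gadget unit :=
  match m with
  | MoveL => bind (test h 12) (fun at0 => if at0 then ret tt else dec h)
  | MoveS => ret tt
  | MoveR => bind (test h lim) (fun at_end => if at_end then ret tt else inc h)
  end.

(** The state of [M] lives in the finite control. The auxiliary tape of [M] is empty, so it always
    reads [None] and its head move is dropped. Halting is checked before the clock, so a run that
    halts exactly at the limit still gives its answer; a timeout answers [false]. *)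
Definition sim_step (M : machine) (q : mQ M) : gadget (mQ M + bool) :=
  if mhalt M q is Some b then ret (inr b) else
  bind (test 3 9) (fun timeout => if timeout then ret (inr false) else
  inc 3 ;;
  bind read_input (fun rx => bind (read_head 10 7 13) (fun rw =>
  bind (read_head 11 6 14) (fun rc =>
    let: (q', mi, _, (bw, mw), (bc, mc)) := mdelta M q rx None rw rc in
    write_head 10 7 13 bw ;; write_head 11 6 14 bc ;;
    shift_head 10 7 mw ;; shift_head 11 6 mc ;;
    move_input mi ;; ret (inl q'))))).

Definition simulator (M : machine) (k e : nat) : gadget bool :=
  init_marks ;; setup k e ;; loopg (@sim_step M) (mq0 M).

Definition tape_rel (s : astate) (h lim tr pos : nat) (tape : seq bool) :=
  [/\ ctr s h = pos, ctr s lim = (size tape).+1, pos <= (size tape).+1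
    & forall p, 0 < p <= size tape -> arr s tr p = nth false tape p.-1].

Lemma size_write_tape s h b : size (write_tape s h b) = size s.
Proof.
by rewrite /write_tape; case: ifP => // /andP[h1 h2]; rewrite size_set_nth; lia.
Qed.

Lemma move_head_le len h m : h <= len.+1 -> move_head len h m <= len.+1.
Proof. by case: m => //=; lia. Qed.

Lemma iter_halted (M : machine) x m c b : mhalt M (cstate c) = Some b ->
  iter m (step M x [::]) c = c.
Proof.
by move=> Hb; elim: m => //= m ->; rewrite /step Hb.
Qed.

Lemma read_tape_nil h : read_tape [::] h = None.
Proof. by rewrite /read_tape; case: h. Qed.

Section Simulation.
Variables (x r : seq bool) (len N : nat).
Hypothesis len_ge : 15 * (N + 2) <= len.
Notation wp := (@wp x r len N _).

Lemma wp_ret_le E (e : E) t (Q : E -> astate -> Prop) s :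
  0 < t -> Q e s -> wp (ret e) t Q s.
Proof. by move=> t0 HQ; apply: (@wp_le _ _ _ _ _ _ 1 _ Q) => //; apply: wp_ret. Qed.

Section Head.
Variables (h lim tr : nat).
Hypotheses (h_lt : h < 12) (lim_lt : lim < 13) (tr_ge : 13 <= tr < 15).
Hypothesis h_lim : h != lim.

Let h13 : h < 13. Proof. lia. Qed.
Let lim15 : lim < 15. Proof. lia. Qed.
Let tr15 : tr < 15. Proof. lia. Qed.
Let trF : (tr < 13) = false. Proof. lia. Qed.

Lemma wp_read_head pos tape (Q : option bool -> astate -> Prop) s :
  tape_rel s h lim tr pos tape -> ctr s 12 = 0 -> Q (read_tape tape pos) s ->
  wp (read_head h lim tr) 4 Q s.
Proof.
move=> [E1 E2 E3 E4] Z HQ; rewrite -[4]/(1 + (1 + (1 + 1))).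
apply: wp_bind; apply: wp_test => //; rewrite /cell /= Z E1.
case: eqP => [p0|p0].
  apply: wp_ret_le => //.
  by move: HQ; rewrite p0 /read_tape.
apply: wp_bind; apply: wp_test => //; rewrite /cell lim_lt E1 E2.
case: eqP => [pe|pe].
  apply: wp_ret_le => //.
  by move: HQ; rewrite pe /read_tape ltnn.
have hp : 0 < pos <= size tape by lia.
apply: wp_bind; apply: wp_test => //; rewrite /cell trF E1 E4 //.
by apply: wp_ret => //; move: HQ; rewrite /read_tape hp.
Qed.

Lemma wp_write_head pos tape b (Q : unit -> astate -> Prop) s :
  tape_rel s h lim tr pos tape -> ctr s 12 = 0 ->
  (forall s', inp s' = inp s -> ctr s' = ctr s ->
     (forall j, j != tr -> arr s' j = arr s j) ->
     tape_rel s' h lim tr pos (write_tape tape pos b) -> Q tt s') ->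
  wp (write_head h lim tr b) 3 Q s.
Proof.
move=> [E1 E2 E3 E4] Z HQ; rewrite -[3]/(1 + (1 + 1)).
apply: wp_bind; apply: wp_test => //; rewrite /cell /= Z E1.
case: eqP => [p0|p0].
  apply: wp_ret_le => //.
  by apply: HQ => //; rewrite /write_tape p0; split=> //; rewrite E1 p0.
apply: wp_bind; apply: wp_test => //; rewrite /cell lim_lt E1 E2.
case: eqP => [pe|pe].
  by apply: wp_ret => //; apply: HQ => //; rewrite /write_tape pe ltnn; split; rewrite // E1 pe.
have hp : 0 < pos <= size tape by lia.
apply: wp_put => //; apply: HQ => //=.
  by move=> j /negPf ->.
split; rewrite ?size_write_tape //= eqxx => p hpt.
rewrite E1 /updb /write_tape hp nth_set_nth /=.
have -> : (p.-1 == pos.-1) = (p == pos) by lia.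
by case: eqP => // _; apply: E4.
Qed.

Lemma wp_shift_head pos tape m (Q : unit -> astate -> Prop) s :
  tape_rel s h lim tr pos tape -> ctr s 12 = 0 -> size tape < N ->
  (tape_rel (setc s h (move_head (size tape) pos m)) h lim tr
     (move_head (size tape) pos m) tape ->
   Q tt (setc s h (move_head (size tape) pos m))) ->
  wp (shift_head h lim m) 2 Q s.
Proof.
move=> [E1 E2 E3 E4] Z sN HQ.
have {HQ} : Q tt (setc s h (move_head (size tape) pos m)).
  apply: HQ; split=> //=; [by rewrite eqxx|by rewrite eq_sym (negPf h_lim)|].
  exact: move_head_le.
rewrite -[2]/(1 + 1); case: m => /= HQ.
- apply: wp_bind; apply: wp_test => //; rewrite /cell /= Z E1.
  case: eqP => [p0|p0]; first by apply: wp_ret => //; move: HQ; rewrite setcK // E1 p0.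
  by apply: wp_dec; rewrite ?E1 //; lia.
- by apply: wp_ret_le => //; rewrite setcK in HQ.
- apply: wp_bind; apply: wp_test => //; rewrite /cell lim_lt E1 E2.
  case: eqP => [pe|pe].
    by apply: wp_ret => //; move: HQ; rewrite setcK // E1 pe; lia.
  apply: wp_inc; rewrite ?E1 //; first by lia.
  by rewrite (_ : minn _ _ = pos.+1) in HQ; last lia.
Qed.

End Head.

Variables (M : machine) (S : nat).

Definition simulates (v : nat) (s : astate) (c : config (mQ M)) :=
  [/\ inp s = cin c, [/\ ctr s 12 = 0, ctr s 9 = S & ctr s 3 = v],
      tape_rel s 10 7 13 (cwork c) (cwtape c),
      tape_rel s 11 6 14 (ccat c) (cctape c)
    & size (cwtape c) < N /\ size (cctape c) < N].

Lemma tape_rel_ext s s' h lim tr pos tape :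
  ctr s' h = ctr s h -> ctr s' lim = ctr s lim -> arr s' tr = arr s tr ->
  tape_rel s h lim tr pos tape -> tape_rel s' h lim tr pos tape.
Proof. by move=> e1 e2 e3 [h1 h2 h3 h4]; split; rewrite ?e1 ?e2 ?e3. Qed.

Lemma wp_sim_step v s c (Q : mQ M + bool -> astate -> Prop) : S <= N -> v < S ->
  mhalt M (cstate c) = None -> simulates v s c ->
  (forall s', let c' := step M x [::] c in
     simulates v.+1 s' c' -> Q (inl (cstate c')) s') ->
  wp (sim_step (cstate c)) 23 Q s.
Proof.
move=> SN vS Hh [Ei [Z ES Ev] Hw Hc [sw sc]] HQ.
rewrite /sim_step Hh -[23]/(1 + (1 + (1 + (4 + (4 + (3 + (3 + (2 + (2 + (1 + 1)))))))))).
apply: wp_bind; apply: wp_test => //; rewrite /cell /= ES Ev ltn_eqF //.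
apply: wp_bind; apply: wp_inc; rewrite // Ev; first by lia.
move: HQ; rewrite /step Hh read_tape_nil => HQ.
apply: wp_bind; apply: wp_read_input => //=; rewrite Ei.
apply: wp_bind; apply: (@wp_read_head 10 7 13 isT isT isT isT (cwork c) (cwtape c)) => //.
apply: wp_bind; apply: (@wp_read_head 11 6 14 isT isT isT isT (ccat c) (cctape c)) => //.
case: (mdelta _ _ _ _ _ _) HQ => [[[[q' mi] ma] [bw mw]] [bc mc]] /= HQ.
apply: wp_bind; apply: (@wp_write_head 10 7 13 isT isT isT isT (cwork c) (cwtape c)) => // s1 I1 C1 A1 W1.
apply: wp_bind; apply: (@wp_write_head 11 6 14 isT isT isT isT (ccat c) (cctape c)) => //.
- by apply: tape_rel_ext Hc; rewrite ?C1 ?A1.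
- by rewrite C1.
move=> s2 I2 C2 A2 W2.
apply: wp_bind; apply: (@wp_shift_head 10 7 13 isT isT isT isT (cwork c) (write_tape (cwtape c) (cwork c) bw)) => //.
- by apply: tape_rel_ext W1; rewrite ?C2 ?A2.
- by rewrite C2 C1.
- by rewrite size_write_tape.
move=> W3; apply: wp_bind.
apply: (@wp_shift_head 11 6 14 isT isT isT isT (ccat c) (write_tape (cctape c) (ccat c) bc)) => //.
- by rewrite /= C2 C1.
- by rewrite size_write_tape.
move=> W4.
apply: wp_bind; apply: wp_move_input => //; apply: wp_ret => //; apply: HQ.
split=> //=.
- by rewrite I2 I1 /= Ei.
- by rewrite C2 C1.
- by rewrite !size_write_tape.
Qed.

(** Leaving the loop early is consistent with a postcondition about the full clock, because a halted
    configuration is a fixed point of [step]. *)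
Lemma wp_simulate m v s c (Q : bool -> astate -> Prop) : S <= N ->
  v + m = S -> simulates v s c ->
  (forall s', Q (odflt false (mhalt M (cstate (iter m (step M x [::]) c)))) s') ->
  wp (loopg (@sim_step M) (cstate c)) (23 * m + 2) Q s.
Proof.
move=> SN; elim: m v s c => [|m IH] v s c Em Hs HQ.
  rewrite -[23 * 0 + 2]/(2 + 0); apply: wp_loop; rewrite /sim_step.
  move: HQ => /=; case: (mhalt M (cstate c)) => [b|] HQ.
    by apply: wp_ret_le => //; apply: HQ.
  case: Hs => _ [_ ES Ev] _ _ _; rewrite -[2]/(1 + 1).
  apply: wp_bind; apply: wp_test => //; rewrite /cell /= ES Ev -Em addn0 eqxx.
  exact: wp_ret.
rewrite mulnS -addnA; apply: wp_loop.
case Hh: (mhalt M (cstate c)) => [b|].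
  rewrite /sim_step Hh; apply: wp_ret_le => //.
  by have := HQ s; rewrite (iter_halted _ _ Hh) Hh.
apply: (wp_sim_step (v := v)) => //; first lia.
move=> s' c' Hs' /=; apply: (IH v.+1 _ _ _ Hs'); first lia.
by move=> s2; have := HQ s2; rewrite iterSr.
Qed.

End Simulation.

(** * Polynomial running time *)

Definition simulator_cost (k e n : nat) : nat :=
  let N := (n + 2) ^ e in
  unit_cost N + (setup_cost n k e N + (23 * N + 2)) * unit_cost N.

(** The same number (n + 2)^e serves as counter capacity and as clock limit; the first n^k random
    bits are the initial catalytic content. *)
Lemma simulator_reaches (M : machine) k e x r len :
  let n := size x in
  15 * ((n + 2) ^ e + 2) <= len -> k + 2 <= e -> n ^ k <= size r ->
  exists c, reaches x r len (simulator M k e) (TS 0 0 0 (fun=> false))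
    (odflt false (mhalt M (cstate
       (run M x [::] (k * up_log 2 n) (take (n ^ k) r) ((n + 2) ^ e)))))
    c (simulator_cost k e n).
Proof.
move=> n len_ge le_ke le_r; set N := (n + 2) ^ e.
set b := odflt _ _.
have H : wp x r len N (setup k e ;; loopg (@sim_step M) (mq0 M))
    (setup_cost n k e N + (23 * N + 2)) (fun b' _ => b' = b) astate0.
  apply: wp_bind; apply: wp_setup => // s [Hi _ Ha Hc].
  apply: (@wp_simulate _ _ _ _ len_ge M N N 0 s
    (init M (k * up_log 2 n) (take (n ^ k) r))) => //.
  have szr : size (take (n ^ k) r) = n ^ k by apply/size_takel.
  split=> //=; [by rewrite !Hc| | |].
  - split; rewrite ?Hc ?size_nseq //= => p /andP[p1 p2].
    by rewrite Ha nth_nseq if_same.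
  - split; rewrite ?Hc ?szr //= => p /andP[p1 p2].
    by rewrite Ha /= /cat_array p1 p2 nth_take //; case: p p1 p2.
  - rewrite size_nseq szr; split.
      exact: ltnW (log_lt_bound n le_ke).
    exact: ltnW (pow_lt_bound n le_ke).
have ok0 : ok N astate0 by [].
have [b' [s' [Hr _ Eb]]] := H ok0; exists (phys s'); rewrite -Eb.
exact: reaches_bind (reaches_init_marks x r len_ge) Hr.
Qed.

Definition poly_bounded (f : nat -> nat) :=
  exists c d, forall n, f n <= c * (n + 2) ^ d.

Lemma poly_bounded_const c : poly_bounded (fun=> c).
Proof. by exists c, 0 => n; rewrite expn0 muln1. Qed.

Lemma poly_bounded_id : poly_bounded id.
Proof. by exists 1, 1 => n; rewrite expn1; lia. Qed.

Lemma poly_boundedD f g :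
  poly_bounded f -> poly_bounded g -> poly_bounded (fun n => f n + g n).
Proof.
move=> [c [d Hf]] [c' [d' Hg]]; exists (c + c'), (d + d') => n.
rewrite mulnDl; apply: leq_add; [apply: leq_trans (Hf n) _|apply: leq_trans (Hg n) _];
  by rewrite leq_mul2l leq_exp2l ?leq_addr ?leq_addl ?orbT //; lia.
Qed.

Lemma poly_boundedM f g :
  poly_bounded f -> poly_bounded g -> poly_bounded (fun n => f n * g n).
Proof.
move=> [c [d Hf]] [c' [d' Hg]]; exists (c * c'), (d + d') => n.
by rewrite expnD mulnACA leq_mul.
Qed.

Lemma poly_boundedX f e : poly_bounded f -> poly_bounded (fun n => f n ^ e).
Proof.
move=> Hf; elim: e => [|e IH]; first exact: poly_bounded_const 1.
have [c [d H]] := poly_boundedM Hf IH.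
by exists c, d => n; rewrite expnS.
Qed.

(** For n >= 2 one has n + 2 <= n^2 and K <= n^K, so the power suffices. For n <= 1 powers of n do
    not grow, and the additive c must exceed K * 3^d. *)
Lemma poly_bounded_pow f : poly_bounded f -> exists c, forall n, f n <= n ^ c + c.
Proof.
move=> [K [d Hf]]; exists (K * 3 ^ d + K + 2 * d) => n.
apply: leq_trans (Hf n) _; case: (leqP n 1) => n1.
  have : (n + 2) ^ d <= 3 ^ d by case: (d) => // d'; rewrite leq_exp2r //; lia.
  by move/(leq_mul (leqnn K)); lia.
apply: leq_trans (leq_addr _ _).
apply: (@leq_trans (n ^ K * n ^ (2 * d))); last by rewrite -expnD leq_exp2l //; lia.
apply: leq_mul; first exact: ltnW (ltn_expl _ n1).
rewrite expnM; case: (d) => // d'; rewrite leq_exp2r //; nia.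
Qed.

(** The summands are the three demands on T: running time, work tape length and number of random
    bits. *)
Lemma poly_bounded_simulator k e :
  poly_bounded (fun n => simulator_cost k e n + (15 * ((n + 2) ^ e + 2) + n ^ k)).
Proof.
rewrite /simulator_cost /setup_cost /unit_cost /mul_cost.
by repeat first [exact: poly_bounded_const | exact: poly_bounded_id
  | apply: poly_boundedD | apply: poly_boundedM | apply: poly_boundedX].
Qed.

(** * Counting slow initial contents *)

Definition diff_positions (P : nat) (s t : seq bool) : seq nat :=
  [seq i <- iota 0 P | nth false s i != nth false t i].

Lemma size_diff_positions P s t : size s = P -> size t = P ->
  size (diff_positions P s t) = hamming s t.
Proof.
move=> sz1 sz2; rewrite /hamming sz1 sz2 maxnn minnn subnn addn0 size_filter.
have -> : zip s t = [seq (nth false s i, nth false t i) | i <- iota 0 P].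
  apply: (@eq_from_nth _ (false, false)); first by rewrite size_zip size_map size_iota; lia.
  move=> i; rewrite size_zip sz1 sz2 minnn => hi.
  by rewrite nth_zip ?sz1 // (nth_map 0) ?size_iota // nth_iota.
by rewrite count_map; apply: eq_count.
Qed.

(** The list of at most d positions is padded to length d with P, which is no position; hence the
    range 'I_P.+1 and the count (P + 1)^d. *)
Definition diff_code (P d : nat) (s t : seq bool) : {ffun 'I_d -> 'I_P.+1} :=
  [ffun i : 'I_d => inord (nth P (diff_positions P s t) i)].

Lemma diff_codeE P d s t j : size (diff_positions P s t) <= d -> j < P ->
  (j \in diff_positions P s t) = [exists i, diff_code P d s t i == j :> nat].
Proof.
move=> szd hj.
have H i : nth P (diff_positions P s t) i < P.+1.
  case: (ltnP i (size (diff_positions P s t))) => hi; last by rewrite nth_default.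
  by have := mem_nth P hi; rewrite mem_filter mem_iota add0n => /and3P[_ _ /ltnW].
apply/idP/existsP => [jin|[i]].
  have hi : index j (diff_positions P s t) < d.
    by apply: leq_trans szd; rewrite index_mem.
  by exists (Ordinal hi); rewrite ffunE inordK //= nth_index.
rewrite ffunE inordK // => /eqP Ej; rewrite -Ej; apply: mem_nth.
by rewrite ltnNge; apply/negP => /(nth_default P) E; rewrite -Ej E ltnn in hj.
Qed.

(** Over bits, s is t flipped at the coded positions. *)
Lemma diff_code_inj P d s s' t : size s = P -> size s' = P -> size t = P ->
  hamming s t <= d -> hamming s' t <= d ->
  diff_code P d s t = diff_code P d s' t -> s = s'.
Proof.
move=> sz1 sz2 sz3; rewrite -!(size_diff_positions (P := P)) // => h1 h2 Ec.
apply: (@eq_from_nth _ false) => [|i]; rewrite sz1 // => hi.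
have := diff_codeE h1 hi; rewrite Ec -diff_codeE // !mem_filter mem_iota /= add0n hi !andbT.
by case: (nth false s i); case: (nth false s' i); case: (nth false t i).
Qed.

Lemma mktuple_nth_inj n (s t : seq bool) : size s = n -> size t = n ->
  [tuple nth false s i | i < n] = [tuple nth false t i | i < n] -> s = t.
Proof.
move=> sz1 sz2 E; apply: (@eq_from_nth _ false) => [|i]; rewrite sz1 // => hi.
by have := congr1 (fun u => tnth u (Ordinal hi)) E; rewrite !tnth_mktuple.
Qed.

Section Configurations.
Variables (M : machine) (x : seq bool) (W P : nat).

Definition bounded_config (c : config (mQ M)) :=
  [/\ cin c < (size x).+2, caux c < 2, cwork c < W.+2 /\ ccat c < P.+2,
      size (cwtape c) = W & size (cctape c) = P].

Lemma bounded_step c : bounded_config c -> bounded_config (step M x [::] c).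
Proof.
move=> Hc; rewrite /step; case: (mhalt M (cstate c)) => // .
case: (mdelta _ _ _ _ _ _) => [[[[q' mi] ma] [bw mw]] [bc mc]].
case: Hc => h1 h2 [h3 h4] h5 h6.
by split; rewrite /= ?size_write_tape ?h5 ?h6 //; try split; apply: move_head_le.
Qed.

Lemma bounded_run tau t : size tau = P -> bounded_config (run M x [::] W tau t).
Proof.
move=> szt; elim: t => [|t IH]; last exact: bounded_step.
by split; rewrite //= size_nseq.
Qed.

Definition config_code : finType :=
  (mQ M * 'I_(size x).+2 * 'I_2 * 'I_W.+2 * 'I_P.+2 * W.-tuple bool * P.-tuple bool)%type.

Definition encode_config (c : config (mQ M)) : config_code :=
  (cstate c, inord (cin c), inord (caux c), inord (cwork c), inord (ccat c),
   [tuple nth false (cwtape c) i | i < W], [tuple nth false (cctape c) i | i < P]).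

Lemma encode_config_inj c c' : bounded_config c -> bounded_config c' ->
  encode_config c = encode_config c' -> c = c'.
Proof.
case: c => q a b h g w t [/= h1 h2 [h3 h4] h5 h6].
case: c' => q' a' b' h' g' w' t' [/= k1 k2 [k3 k4] k5 k6] E.
congr Config.
- exact: (congr1 (fun p => p.1.1.1.1.1.1) E).
- by have /(congr1 val) := congr1 (fun p => p.1.1.1.1.1.2) E; rewrite /= !inordK.
- by have /(congr1 val) := congr1 (fun p => p.1.1.1.1.2) E; rewrite /= !inordK.
- by have /(congr1 val) := congr1 (fun p => p.1.1.1.2) E; rewrite /= !inordK.
- by have /(congr1 val) := congr1 (fun p => p.1.1.2) E; rewrite /= !inordK.
- exact: mktuple_nth_inj h5 k5 (congr1 (fun p => p.1.2) E).
- exact: mktuple_nth_inj h6 k6 (congr1 (fun p => p.2) E).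
Qed.

Lemma run_add tau t m :
  run M x [::] W tau (t + m) = iter m (step M x [::]) (run M x [::] W tau t).
Proof. by rewrite /run addnC iterD. Qed.

Lemma run_halted tau t b u : mhalt M (cstate (run M x [::] W tau t)) = Some b ->
  t <= u -> run M x [::] W tau u = run M x [::] W tau t.
Proof. by move=> Hb htu; rewrite -(subnKC htu) run_add (iter_halted _ _ Hb). Qed.

(** The two runs continue identically, and u + u' steps later both have halted. *)
Lemma meeting_runs tau tau' t t' u u' b b' fin fin' :
  halts_with M x [::] W tau u b fin -> halts_with M x [::] W tau' u' b' fin' ->
  run M x [::] W tau t = run M x [::] W tau' t' -> fin = fin'.
Proof.
move=> /andP[/eqP h1 /eqP <-] /andP[/eqP h2 /eqP <-] E.
have := congr1 (iter (u + u') (step M x [::])) E.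
rewrite -!run_add (run_halted h1) ?(run_halted h2); try lia.
by move=> ->.
Qed.

(** A repeated configuration makes the run periodic, so the configuration at t recurs after the
    halting time and is itself halted. Being unhalted at S excludes this; without it the final
    configuration would repeat harmlessly. *)
Lemma halting_run_inj tau t t' u b fin S : halts_with M x [::] W tau u b fin ->
  mhalt M (cstate (run M x [::] W tau S)) = None ->
  t < t' -> t' <= S -> run M x [::] W tau t = run M x [::] W tau t' -> False.
Proof.
move=> /andP[/eqP h1 _] hS htt' ht'S E.
have Hper j : run M x [::] W tau (t + j * (t' - t)) = run M x [::] W tau t.
  elim: j => [|j IH]; first by rewrite mul0n addn0.
  by rewrite mulSn addnA (subnKC (ltnW htt')) run_add -E -run_add.
have hu : u <= t + u * (t' - t) by nia.
have Ht : mhalt M (cstate (run M x [::] W tau t)) = Some b.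
  by rewrite -(Hper u) (run_halted h1 hu).
by move: hS; rewrite (run_halted Ht) ?Ht //; lia.
Qed.

Variables (f : P.-tuple bool -> seq bool) (b : bool) (S d : nat).
Hypothesis halts : forall tau : P.-tuple bool, exists t,
  halts_with M x [::] W tau t b (f tau).

Definition slow_set : {set P.-tuple bool} :=
  [set tau : P.-tuple bool | (hamming tau (f tau) <= d) &&
    (mhalt M (cstate (run M x [::] W tau S)) == None)].

Lemma size_final tau : size (f tau) = P.
Proof.
have [t /andP[_ /eqP <-]] := halts tau.
by case: (@bounded_run tau t (size_tuple tau)).
Qed.

(* A configuration determines the final catalytic content, of which the
   initial content is a perturbation of distance at most [d]; the initial
   content and the configuration together determine the time. *)
Lemma card_slow_set : #|slow_set| * S <= #|config_code| * P.+1 ^ d.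
Proof.
have -> : #|slow_set| * S = #|setX slow_set [set: 'I_S]|.
  by rewrite cardsX cardsT card_ord.
have -> : #|config_code| * P.+1 ^ d = #|{: config_code * {ffun 'I_d -> 'I_P.+1}}|.
  by rewrite [RHS]card_prod card_ffun !card_ord.
pose g (p : P.-tuple bool * 'I_S) : config_code * {ffun 'I_d -> 'I_P.+1} :=
  (encode_config (run M x [::] W p.1 p.2), diff_code P d p.1 (f p.1)).
rewrite -(card_in_imset (f := g)); first exact: max_card.
move=> [tau t] [tau' t']; rewrite !inE /= !andbT => /andP[h1 /eqP s1] /andP[h2 /eqP s2].
move=> E; have Ed := congr1 snd E.
have Ec := encode_config_inj (bounded_run t (size_tuple tau))
  (bounded_run t' (size_tuple tau')) (congr1 fst E).
have [u Hu] := halts tau; have [u' Hu'] := halts tau'.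
have Ef := meeting_runs Hu Hu' Ec; rewrite /= -Ef in Ed h2.
have Et : tau = tau'.
  by apply: val_inj; apply: diff_code_inj Ed; rewrite ?size_tuple ?size_final.
rewrite -Et in Ec *; congr pair; apply: val_inj.
case: (ltngtP t t') => // htt.
  by case: (halting_run_inj Hu s1 htt (ltnW (ltn_ord t')) Ec).
by case: (halting_run_inj Hu s1 htt (ltnW (ltn_ord t)) (esym Ec)).
Qed.

Lemma card_config_code : #|config_code| =
  #|mQ M| * (size x).+2 * 2 * W.+2 * P.+2 * 2 ^ W * 2 ^ P.
Proof. by rewrite !card_prod !card_ord !card_tuple card_bool. Qed.

Lemma markov_card E :
  \sum_(tau : P.-tuple bool) hamming tau (f tau) <= E * 2 ^ P ->
  6 * #|[set tau : P.-tuple bool | 6 * E < hamming tau (f tau)]| <= 2 ^ P.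
Proof.
set B := [set _ | _] => Hsum.
have H : #|B| * (6 * E).+1 <= E * 2 ^ P.
  apply: leq_trans Hsum; rewrite -sum_nat_const.
  rewrite [X in _ <= X](bigID (mem B)) /=.
  by apply: leq_trans (leq_addr _ _); apply: leq_sum => tau; rewrite inE.
(* If E = 0, strictness gives each far content weight at least 1, so there is none; otherwise E is
   cancelled. *)
case: E @B H {Hsum} => [|E] B H; first by lia.
rewrite -(leq_pmul2l (ltn0Sn E)); apply: leq_trans H; lia.
Qed.

End Configurations.

(** * The probability of timeout *)

Import Order.TTheory GRing.Theory Num.Theory.

(** One summand per factor bounded by a power of n + 2: 3 for the constant 6, q for the states, 1
    and 1 for the input and auxiliary heads, k + 2 for each of the work and catalytic heads, 2 * k
    for the work tape contents, and (k + 2) * d for the difference codes. *)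
Definition clock_exponent (q k d : nat) : nat :=
  3 + (q + 1 + 1 + (k + 2) + (k + 2) + (2 * k)) + (k + 2) * d.

Lemma clock_bound q k d n :
  6 * (q * n.+2 * 2 * (k * up_log 2 n).+2 * (n ^ k).+2 * 2 ^ (k * up_log 2 n)
    * (n ^ k).+1 ^ d) <= (n + 2) ^ clock_exponent q k d.
Proof.
set W := k * up_log 2 n; set P := n ^ k; have n2 : 1 < n + 2 by lia.
have hP : P.+2 <= (n + 2) ^ (k + 2) by exact: pow_lt_bound.
have hW : W.+2 <= (n + 2) ^ (k + 2) by exact: log_lt_bound.
have h6 : 6 <= (n + 2) ^ 3 by rewrite !expnS expn0; nia.
have -> : (n + 2) ^ clock_exponent q k d = (n + 2) ^ 3 * ((n + 2) ^ q * (n + 2) * (n + 2) *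
    (n + 2) ^ (k + 2) * (n + 2) ^ (k + 2) * (n + 2) ^ (2 * k) * (n + 2) ^ ((k + 2) * d)).
  by rewrite -!expnSr -!expnD; congr expn; rewrite /clock_exponent; lia.
apply: leq_mul; first exact: h6.
apply: leq_mul; last first.
  by rewrite expnM; case: (d) => // d'; rewrite leq_exp2r //; apply: ltnW.
apply: leq_mul; last first.
  rewrite /W mulnC 2!expnM; case: (k) => // k'; rewrite leq_exp2r //.
  by apply: leq_trans (up_log2_bound n) _; nia.
do 2 (apply: leq_mul; last by []); apply: leq_mul; last exact: n2.
apply: leq_mul; last by rewrite addn2.
exact: ltnW (ltn_expl _ n2).
Qed.

Lemma card_fast (M : machine) x k E b (f : (size x ^ k).-tuple bool -> seq bool) :
  let P := size x ^ k in let W := k * up_log 2 (size x) in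
  let S := (size x + 2) ^ clock_exponent #|mQ M| k (6 * E) in
  (forall tau : P.-tuple bool, exists t, halts_with M x [::] W tau t b (f tau)) ->
  \sum_(tau : P.-tuple bool) hamming tau (f tau) <= E * 2 ^ P ->
  2 * 2 ^ P <= 3 * #|[set tau : P.-tuple bool |
    mhalt M (cstate (run M x [::] W tau S)) == Some b]|.
Proof.
move=> P W S Hh Hsum; set A := [set tau | _].
have hB := markov_card Hsum; set B := [set tau | _] in hB.
have hG := card_slow_set S (6 * E) Hh; set G := slow_set _ _ _ _ _ _ in hG.
have S0 : 0 < S by rewrite expn_gt0 addn2.
have {}hG : 6 * #|G| <= 2 ^ P.
  rewrite -(leq_pmul2r S0) -mulnA; apply: leq_trans (leq_mul (leqnn 6) hG) _.
  have := leq_mul (clock_bound #|mQ M| k (6 * E) (size x)) (leqnn (2 ^ P)).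
  rewrite card_config_code -/P -/W -/S [2 ^ P * S]mulnC; apply: leq_trans.
  by apply: eq_leq; rewrite [in LHS]mulnAC mulnA.
(* A content that is near its final one and has halted by time S must answer b, as its halting
   configuration is unique; every failure is therefore far or slow. *)
have hAC : ~: A \subset B :|: G.
  apply/subsetP => tau; rewrite !inE; case: (ltnP (6 * E)) => //= _ hA.
  case E1 : (mhalt _ _) => [b'|] //.
  have [t /andP[/eqP ht _]] := Hh tau; move: hA.
  have := run_halted ht (leq_maxl t S); have := run_halted E1 (leq_maxr t S).
  by move=> -> E2; rewrite E2 ht eqxx.
have arith a a' u v p : 6 * u <= p -> 6 * v <= p -> a + a' = p -> a' <= u + v ->
  2 * p <= 3 * a by lia.
apply: arith hB hG _ (leq_trans (subset_leq_card hAC) (leq_card_setU B G)).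
by rewrite cardsC card_tuple card_bool.
Qed.

(** Only a prefix of the random string is used; each prefix has 2^(T - P) extensions, so its success
    probability carries over. *)
Lemma card_prefix P T (A : {set P.-tuple bool}) (PT : P <= T)
    (B : {set T.-tuple bool}) :
  (forall (r : T.-tuple bool) (tau : P.-tuple bool),
     take P r = tau -> tau \in A -> r \in B) ->
  #|A| * 2 ^ (T - P) <= #|B|.
Proof.
move=> HB; pose g (p : P.-tuple bool * (T - P).-tuple bool) : T.-tuple bool :=
  tcast (subnKC PT) (cat_tuple p.1 p.2).
have vg p : tval (g p) = p.1 ++ p.2 by rewrite val_tcast.
have g_inj : injective g.
  move=> [u v] [u' v'] /(congr1 (@tval _ _)); rewrite !vg /= => /eqP.
  by rewrite eqseq_cat ?size_tuple // => /andP[/eqP/val_inj -> /eqP/val_inj ->].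
have -> : #|A| * 2 ^ (T - P) = #|g @: setX A setT|.
  by rewrite card_imset // cardsX cardsT card_tuple card_bool.
apply: subset_leq_card; apply/subsetP => r /imsetP[[u v]]; rewrite inE /= => /andP[uA _] ->.
by apply: (HB _ u) => //; rewrite vg take_size_cat ?size_tuple.
Qed.

Theorem theorem6p8 (L : language) : AVG_LCL L -> BPP L.
Proof.
case=> k [e [M HM]]; pose E := Num.bound e.
pose ex := clock_exponent #|mQ M| k (6 * E).
have le_ex : k + 2 <= ex by rewrite /ex /clock_exponent; lia.
have [c Hc] := poly_bounded_pow (poly_bounded_simulator k ex).
exists c, (machine_of (simulator M k ex)) => x; set n := size x; set T := n ^ c + c.
have arith a b p t : a + (b + p) <= t -> [/\ a <= t, b <= t & p <= t] by split; lia.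
have [le_cost le_len PT] := arith _ _ _ _ (Hc n).
rewrite -/T in le_cost le_len PT.
have [f [Hh Hsum]] := HM x; rewrite -/n in f Hh Hsum.
have Hrun (r : T.-tuple bool) : exists2 t, t <= T & halts_with (machine_of (simulator M k ex))
    x r T [::] t (odflt false (mhalt M (cstate
       (run M x [::] (k * up_log 2 n) (take (n ^ k) r) ((n + 2) ^ ex))))) [::].
  have [|c' Hr] := simulator_reaches M (r := r) le_len le_ex; first by rewrite size_tuple.
  exact: machine_of_reaches (reaches_le le_cost Hr).
split=> [r|].
  have [t lt Ht] := Hrun r; apply/existsP; exists (Ordinal (lt : t < T.+1)).
  by move: Ht => /andP[/eqP]; rewrite /halted_by => ->.
have {}Hsum : \sum_(tau : (n ^ k).-tuple bool) hamming tau (f tau) <= E * 2 ^ (n ^ k).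
  have p0 : (0 < (2 ^ (n ^ k))%:R :> rat)%R by rewrite ltr0n expn_gt0.
  (* Nonnegativity of e is what lets [Num.bound] serve as an integer upper bound; it is inherited
     from the expectation. *)
  have e0 : (0 <= e)%R by apply: le_trans Hsum; rewrite divr_ge0 ?ler0n.
  rewrite -(ler_nat rat) natrM -ler_pdivrMr //.
  by apply: le_trans Hsum _; apply: ltW; apply: archi_boundP.
have HA := card_fast Hh Hsum; set A := [set tau | _] in HA.
set B := [set r | _].
have HAB : #|A| * 2 ^ (T - n ^ k) <= #|B|.
  apply: card_prefix => // r tau Etau; rewrite !inE => /eqP Ht.
  have [t lt] := Hrun r; rewrite Etau Ht /= => Hw.
  by apply/existsP; exists (Ordinal (lt : t < T.+1)).
apply: leq_trans (leq_mul (leqnn 3) HAB); rewrite mulnA -{1}(subnKC PT) expnD mulnA.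
exact: leq_mul HA (leqnn _).
Qed.
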